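(* Let $\nu\ge 1/2$ and let $$\mathcal{B}_{\nu}(z)= \sum_{n=0}^\infty \frac{ \Gamma(\nu+1)\,\Gamma\!\left(\frac{n+1}{2}\right)}{\sqrt{\pi}\, n!\, \Gamma\!\left(\frac{n}{2}+\nu+1\right)}\, z^n ,\qquad z\in\mathbb{D}=\{z\in\mathbb{C}:|z|<1\}.$$ Then the function $f(z)=z\mathcal{B}_\nu(z)$ is starlike (univalent) in $\mathbb{D}$. Moreover, $f$ is close-to-convex with respect to the starlike function $g(z)=z$ and also with respect to the starlike function $g(z)=z/(1-z)$.
   Context: $\mathcal{B}_\nu$ is the Bessel–Struve kernel function; $f(z)=z\mathcal{B}_\nu(z)$ satisfies $f(0)=0$, $f'(0)=1$. A function $f$ analytic in $\mathbb{D}$ with $f(0)=0,f'(0)=1$ is starlike if $f$ is univalent and $f(\mathbb{D})$ is starlike with respect to the origin, equivalently $\operatorname{Re}(zf'(z)/f(z))>0$ on $\mathbb{D}$. Given a starlike function $g$, $f$ is close-to-convex with respect to $g$ if there exists a real $\beta$ such that $\operatorname{Re}\left(e^{i\beta}\, z f'(z)/g(z)\right)>0$ for all $z\in\mathbb{D}$. *)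

(* Defs.v *)
From Stdlib Require Import Reals.
From Coquelicot Require Import Coquelicot.
Open Scope R_scope.

Definition Gamma (x : R) : R :=
  RInt_gen (fun t => Rpower t (x - 1) * exp (- t))
           (at_right 0) (Rbar_locally p_infty).

Definition BS_coef (nu : R) (n : nat) : R :=
  Gamma (nu + 1) * Gamma ((INR n + 1) / 2)
  / (sqrt PI * INR (Factorial.fact n) * Gamma (INR n / 2 + nu + 1)).

Definition BS_partial (nu : R) (z : C) (N : nat) : C :=
  sum_n (fun n => RtoC (BS_coef nu n) * pow_n z n)%C N.

Definition Bnu (nu : R) (z : C) : C :=
  (real (Lim_seq (fun N => Re (BS_partial nu z N))),
   real (Lim_seq (fun N => Im (BS_partial nu z N)))).

Definition in_disk (z : C) : Prop := Cmod z < 1.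

Definition normalized_analytic (f : C -> C) : Prop :=
  (forall z, in_disk z -> exists d : C, @is_derive C_AbsRing _ f z d) /\
  f (RtoC 0) = RtoC 0 /\ @is_derive C_AbsRing _ f (RtoC 0) (RtoC 1).

Definition starlike (f : C -> C) : Prop :=
  normalized_analytic f /\
  (forall z w, in_disk z -> in_disk w -> f z = f w -> z = w) /\
  (forall z (t : R), in_disk z -> 0 <= t <= 1 ->
     exists w, in_disk w /\ f w = (RtoC t * f z)%C).

(* Close-to-convex with respect to a starlike g: there is a real beta with
   Re(e^{i beta} z f'(z)/g(z)) > 0 on D; at z = 0 the quotient is understood
   as its (removable) value f'(0)/g'(0). *)
Definition close_to_convex_wrt (f g : C -> C) : Prop :=
  normalized_analytic f /\ starlike g /\
  exists beta : R, forall z, in_disk z ->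
    exists df dg : C,
      @is_derive C_AbsRing _ f z df /\ @is_derive C_AbsRing _ g z dg /\
      (z <> RtoC 0 ->
         0 < Re ((cos beta, sin beta) * (z * df / g z))%C) /\
      (z = RtoC 0 ->
         0 < Re ((cos beta, sin beta) * (df / dg))%C).

(* Main.v *)
(* The function [f z = z * Bnu nu z] has [f' z = sum m_n z^n / n!] with
   [m_n = kappa * Gamma ((n + 3) / 2) / Gamma (n / 2 + nu + 1)] and [m_0 = 1].  For [nu >= 1/2]
   the sequence [m] is a pointwise limit of finite products of factors [c * (1 + d / (n + j))]
   with [d >= 0]; multiplying the coefficients of a power series by such a factor preserves
   nonnegativity on [[0, 1]], so [p |-> sum m_n p_n] is a positive functional and [f' z]
   behaves like an average of [exp (z t)], [0 <= t <= 1].  The same holds for [f z / z],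
   with the weights [m_n / (n + 1)].  Hence, with [y = Im z], both quantities have real part
   at least [exp (-1) * cos 1] and imaginary part of the sign of [y].  This gives
   [Re f' > 0], [Re ((1 - z) f') > 0] and [Re (z f' / f) > 0] at once.  Univalence follows from
   [Re f' > 0] on a convex domain.  For the segments [[0, f z]], Euler's scheme for
   [w' = - f w / f' w] never increases [|w|] and converges because [f] is expansive. *)
Require Import Defs.
From Stdlib Require Import Reals Factorial Lra Lia Psatz.
From Coquelicot Require Import Coquelicot.
Open Scope R_scope.

(** * The Gamma integral *)

(** For [nu > 1/2] the numbers [m_n] are the moments of the probability density proportional to
    [t^2 (1 - t^2)^(nu - 3/2)] on [0, 1]; at [nu = 1/2] this degenerates to the point mass at 1,
    where [f' = exp]. A positive functional treats both cases alike. The finite products come from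
    [m_(n+2) / m_n = (n + 3) / (n + 2 nu + 2)]. This recursion links only indices of equal parity;
    that [m_(n+1) / m_n] tends to 1, a consequence of the log-convexity of [Gamma], ties the two
    parities together. The signs of the imaginary parts are what goes beyond [Re f' > 0]: with
    [z = x + i y], both [Re ((1 - z) f') = (1 - x) Re f' + y Im f'] and [Re (B conj(f')) = Re B Re
    f' + Im B Im f'] are a positive plus a nonnegative term. [starlike] speaks of segments in the
    image, so the radial condition has to be integrated. Bounds uniform over the whole open disk
    make the total Euler error vanish with the step. *)

Lemma Rpower_pos_lt (t x : R) : 0 < Rpower t x.
Proof. apply exp_pos. Qed.

(** For a nonnegative integrand the integral grows with the interval, so the limit is the supremum
    over compact subintervals of (0, oo). *)
Lemma ex_RInt_gen_nonneg_bounded (f : R -> R) (K : R) :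
  (forall t, 0 < t -> continuous f t) ->
  (forall t, 0 < t -> 0 <= f t) ->
  (forall a b, 0 < a -> a <= b -> RInt f a b <= K) ->
  ex_RInt_gen f (at_right 0) (Rbar_locally p_infty).
Proof.
intros Hc Hp HK.
assert (Hex : forall a b, 0 < a -> a <= b -> ex_RInt f a b).
{ intros a b Ha Hab. apply (ex_RInt_continuous (V := R_CompleteNormedModule)).
  intros t Ht. apply Hc. rewrite Rmin_left in Ht; lra. }
set (E := fun y => exists a b, 0 < a /\ a <= b /\ y = RInt f a b).
destruct (completeness E) as [l [Hub Hlub]].
{ exists K. intros y (a & b & Ha & Hab & ->). auto. }
{ exists (RInt f 1 1), 1, 1. lra. }
exists l. intros P [eps HP].
assert (Hnear : exists a b, 0 < a /\ a <= b /\ l - eps < RInt f a b).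
{ destruct (Classical_Prop.classic (exists a b, 0 < a /\ a <= b /\ l - eps < RInt f a b)) as [H|H]; [exact H|].
  exfalso. assert (l <= l - eps); [|destruct eps as [e He]; simpl in *; lra].
  apply Hlub. intros y (a & b & Ha & Hab & ->).
  apply Rnot_lt_le. intros Hlt. apply H. exists a, b. auto. }
destruct Hnear as (a0 & b0 & Ha0 & Hab0 & Hl).
apply Filter_prod with (fun a => 0 < a < a0) (fun b => b0 < b).
- exists (mkposreal _ Ha0). intros y Hy H0. split; [exact H0|].
  unfold ball in Hy; simpl in Hy; unfold AbsRing_ball, abs, minus, plus, opp in Hy; simpl in Hy.
  apply Rabs_def2 in Hy. lra.
- exists b0. auto.
- intros a b [Ha Haa] Hb. exists (RInt f a b). split.
  + apply (RInt_correct (V := R_CompleteNormedModule)). apply Hex; simpl; lra.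
  + apply HP. change (Rabs (RInt f a b - l) < eps).
    assert (RInt f a b <= l) by (apply Hub; exists a, b; repeat split; simpl; lra).
    assert (RInt f a0 b0 <= RInt f a b).
    { rewrite <- (RInt_Chasles f a a0 b) by (apply Hex; simpl; lra).
      rewrite <- (RInt_Chasles f a0 b0 b) by (apply Hex; simpl; lra).
      assert (0 <= RInt f a a0) by (apply RInt_ge_0; [lra | apply Hex; lra | intros; apply Hp; lra]).
      assert (0 <= RInt f b0 b) by (apply RInt_ge_0; [lra | apply Hex; lra | intros; apply Hp; lra]).
      unfold plus; simpl. lra. }
    rewrite Rabs_left1; lra.
Qed.

(** Transfers positivity of an integrand to its improper integral; with [a = b] it reads
    [0 <= l]. *)
Lemma is_RInt_gen_ge_RInt (f : R -> R) (l a b : R) :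
  (forall t, 0 < t -> continuous f t) ->
  (forall t, 0 < t -> 0 <= f t) ->
  is_RInt_gen f (at_right 0) (Rbar_locally p_infty) l ->
  0 < a -> a <= b -> RInt f a b <= l.
Proof.
intros Hc Hp Hl Ha Hab. apply Rnot_lt_le. intros Hlt.
assert (Hex : forall a b, 0 < a -> a <= b -> ex_RInt f a b).
{ intros c d Hc0 Hcd. apply (ex_RInt_continuous (V := R_CompleteNormedModule)).
  intros t Ht. apply Hc. rewrite Rmin_left in Ht; lra. }
assert (He : 0 < RInt f a b - l) by lra.
destruct (Hl (fun y => y < RInt f a b)) as [Q R [d Hd] [M HM] H].
{ exists (mkposreal _ He). intros y Hy. change (Rabs (y - l) < RInt f a b - l) in Hy.
  apply Rabs_def2 in Hy. lra. }
assert (Hd0 : 0 < d) by apply cond_pos.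
(* [a'] and [b'] lie in the neighbourhoods given by the two filters and enclose [a, b]. *)
set (a' := Rmin (d / 2) a). set (b' := Rmax b M + 1).
assert (Ha' : 0 < a') by (apply Rmin_glb_lt; lra).
assert (a' <= d / 2) by apply Rmin_l.
assert (a' <= a) by apply Rmin_r.
assert (b + 1 <= b') by (unfold b'; generalize (Rmax_l b M); lra).
destruct (H a' b') as [y [Hy Hy0]].
- apply Hd; [|exact Ha']. change (Rabs (a' - 0) < d). rewrite Rabs_right; lra.
- apply HM. unfold b'. generalize (Rmax_r b M); lra.
- simpl in Hy. apply (is_RInt_unique (V := R_CompleteNormedModule)) in Hy.
  rewrite <- (RInt_Chasles (V := R_CompleteNormedModule) f a' a b') in Hy by (apply Hex; lra).
  rewrite <- (RInt_Chasles (V := R_CompleteNormedModule) f a b b') in Hy by (apply Hex; lra).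
  assert (0 <= RInt f a' a) by (apply RInt_ge_0; [lra | apply Hex; lra | intros; apply Hp; lra]).
  assert (0 <= RInt f b b') by (apply RInt_ge_0; [lra | apply Hex; lra | intros; apply Hp; lra]).
  unfold plus in Hy; simpl in Hy. lra.
Qed.

Lemma is_RInt_gen_antiderivative (F f : R -> R) (la lb : R) :
  (forall t, 0 < t -> is_derive F t (f t)) ->
  (forall t, 0 < t -> continuous f t) ->
  filterlim F (at_right 0) (locally la) ->
  filterlim F (Rbar_locally p_infty) (locally lb) ->
  is_RInt_gen f (at_right 0) (Rbar_locally p_infty) (lb - la).
Proof.
intros HF Hf Ha Hb.
assert (Hpos : filter_prod (at_right 0) (Rbar_locally p_infty)
  (fun ab : R * R => 0 < fst ab /\ 0 < snd ab)).
{ apply Filter_prod with (fun a => 0 < a) (fun b => 0 < b).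
  - exists (mkposreal 1 Rlt_0_1). auto.
  - exists 0. auto.
  - simpl; auto. }
assert (Hmin : forall a b, 0 < a -> 0 < b -> forall t, Rmin a b <= t -> 0 < t).
{ intros a b H1 H2 t Ht. generalize (Rmin_glb_lt a b 0 H1 H2). lra. }
apply (is_RInt_gen_ext (Derive F)).
- eapply filter_imp; [|exact Hpos]. intros [a b] [H1 H2] t Ht; simpl in *.
  apply is_derive_unique, HF. apply (Hmin a b); lra.
- apply is_RInt_gen_Derive; auto.
  + eapply filter_imp; [|exact Hpos]. intros [a b] [H1 H2] t Ht; simpl in *.
    exists (f t). apply HF. apply (Hmin a b); lra.
  + eapply filter_imp; [|exact Hpos]. intros [a b] [H1 H2] t Ht; simpl in *.
    assert (0 < t) by (apply (Hmin a b); lra).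
    apply continuous_ext_loc with f; [|auto].
    exists (mkposreal t H). intros y Hy. change (Rabs (y - t) < t) in Hy.
    apply Rabs_def2 in Hy. symmetry. apply is_derive_unique, HF. lra.
Qed.

Lemma filterlim_at_right_continuous (f : R -> R) (x : R) :
  continuous f x -> filterlim f (at_right x) (locally (f x)).
Proof. intros H P HP. destruct (H P HP) as [d Hd]. exists d. auto. Qed.

Definition gamma_integrand (x t : R) : R := Rpower t (x - 1) * exp (- t).

Lemma gamma_integrand_continuous (x t : R) :
  0 < t -> continuous (gamma_integrand x) t.
Proof.
intros Ht. apply (ex_derive_continuous (V := R_NormedModule)).
unfold gamma_integrand, Rpower. auto_derive. lra.
Qed.

(** The inequality [u <= exp u] at [u = (1 + t) / x], raised to the power [x]. *)
Lemma Rpower_le_exp (x t : R) :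
  0 < x -> 0 < t -> Rpower (1 + t) x <= Rpower x x * exp (1 + t).
Proof.
intros Hx Ht.
assert (H : (1 + t) / x <= exp ((1 + t) / x)).
{ generalize (exp_ineq1_le ((1 + t) / x)). lra. }
assert (0 < (1 + t) / x) by (apply Rdiv_lt_0_compat; lra).
replace (1 + t) with (x * ((1 + t) / x)) at 1 by (field; lra).
rewrite <- Rpower_mult_distr by lra.
apply Rmult_le_compat_l; [apply Rlt_le, Rpower_pos_lt|].
apply Rle_trans with (Rpower (exp ((1 + t) / x)) x).
- apply Rle_Rpower_l; lra.
- unfold Rpower. rewrite ln_exp. right. f_equal. field. lra.
Qed.

(** This is [Rpower_le_exp] with exponent [x + 1]. The majorant is written as a multiple of the
    derivative of [(t / (1 + t)) ^ x], which stays between 0 and 1 on (0, oo), so one bound controls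
    the integral at 0 and at infinity together. *)
Lemma gamma_integrand_le (x t : R) :
  0 < x -> 0 < t ->
  gamma_integrand x t <=
  Rpower (x + 1) (x + 1) * exp 1 / x *
    (x * Rpower (t / (1 + t)) (x - 1) * / (1 + t) ^ 2).
Proof.
intros Hx Ht.
assert (H := Rpower_le_exp (x + 1) t ltac:(lra) Ht).
unfold Rdiv at 2. rewrite <- Rpower_mult_distr; [|lra|apply Rinv_0_lt_compat; lra].
assert (Hp := Rpower_pos_lt t (x - 1)).
replace (x + 1) with ((x - 1) + INR 2) in H at 1 by (simpl; lra).
rewrite Rpower_plus, Rpower_pow in H by lra.
assert (Hi : Rpower (/ (1 + t)) (x - 1) = / Rpower (1 + t) (x - 1)).
{ unfold Rpower. rewrite ln_Rinv by lra. rewrite <- exp_Ropp. f_equal. lra. }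
rewrite Hi. unfold gamma_integrand.
rewrite exp_plus in H. rewrite exp_Ropp.
assert (He := exp_pos t). assert (Hq := Rpower_pos_lt (1 + t) (x - 1)).
assert (H2 : 0 < (1 + t) ^ 2) by (apply pow_lt; lra).
apply Rmult_le_reg_r with (exp t * (Rpower (1 + t) (x - 1) * (1 + t) ^ 2)).
{ apply Rmult_lt_0_compat; [lra|]. apply Rmult_lt_0_compat; lra. }
field_simplify; [|lra|lra].
apply Rmult_le_compat_l with (r := Rpower t (x - 1)) in H; [|lra].
simpl in *. lra.
Qed.

Lemma is_derive_Rpower_ratio (x t : R) : 0 < t ->
  is_derive (fun t => Rpower (t / (1 + t)) x) t
    (x * Rpower (t / (1 + t)) (x - 1) * / (1 + t) ^ 2).
Proof.
intros Ht. assert (0 < t / (1 + t)) by (apply Rdiv_lt_0_compat; lra).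
unfold Rpower. auto_derive; [split; [lra|split; [exact H|exact I]]|].
replace ((x - 1) * ln (t / (1 + t))) with (x * ln (t / (1 + t)) + - ln (t / (1 + t))) by ring.
rewrite exp_plus, exp_Ropp, exp_ln by exact H.
unfold Rdiv; field. lra.
Qed.

Lemma gamma_integrand_integrable (x : R) : 0 < x ->
  is_RInt_gen (gamma_integrand x) (at_right 0) (Rbar_locally p_infty) (Gamma x).
Proof.
intros Hx.
apply (RInt_gen_correct (V := R_CompleteNormedModule)).
set (K := Rpower (x + 1) (x + 1) * exp 1 / x).
assert (HK : 0 < K).
{ apply Rdiv_lt_0_compat; [|lra]. apply Rmult_lt_0_compat; [apply Rpower_pos_lt|apply exp_pos]. }
apply ex_RInt_gen_nonneg_bounded with K.
- intros; now apply gamma_integrand_continuous.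
- intros. apply Rlt_le, Rmult_lt_0_compat; [apply Rpower_pos_lt|apply exp_pos].
- intros a b Ha Hab.
  set (F := fun t => K * Rpower (t / (1 + t)) x).
  set (dF := fun t => K * (x * Rpower (t / (1 + t)) (x - 1) * / (1 + t) ^ 2)).
  assert (HI : is_RInt dF a b (F b - F a)).
  { apply (is_RInt_derive F dF); intros t Ht; rewrite Rmin_left in Ht by lra.
    - apply is_derive_scal. apply is_derive_Rpower_ratio. lra.
    - apply (ex_derive_continuous (V := R_NormedModule)).
      unfold dF, Rpower. auto_derive.
      assert (0 < t / (1 + t)) by (apply Rdiv_lt_0_compat; lra).
      repeat split; [lra|exact H|apply pow_nonzero with (n := 2%nat); lra]. }
  apply Rle_trans with (F b - F a).
  + rewrite <- (is_RInt_unique _ _ _ _ HI).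
    apply RInt_le; [lra| |exists (F b - F a); exact HI|].
    * apply (ex_RInt_continuous (V := R_CompleteNormedModule)).
      intros t Ht; rewrite Rmin_left in Ht by lra. apply gamma_integrand_continuous; lra.
    * intros t Ht. apply gamma_integrand_le; lra.
  + assert (0 < F a) by (apply Rmult_lt_0_compat; [lra|apply Rpower_pos_lt]).
    assert (F b <= K * 1); [|lra].
    apply Rmult_le_compat_l; [lra|].
    assert (0 < b / (1 + b)) by (apply Rdiv_lt_0_compat; lra).
    assert (b / (1 + b) <= 1) by (apply Rle_div_l; lra).
    apply Rle_trans with (Rpower 1 x); [apply Rle_Rpower_l; lra|].
    unfold Rpower. rewrite ln_1, Rmult_0_r, exp_0. lra.
Qed.

Lemma is_Gamma_unique (x l : R) :
  is_RInt_gen (gamma_integrand x) (at_right 0) (Rbar_locally p_infty) l ->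
  Gamma x = l.
Proof. intros H. exact (is_RInt_gen_unique _ _ H). Qed.

Lemma gamma_integrand_pos (x t : R) : 0 < gamma_integrand x t.
Proof. apply Rmult_lt_0_compat; [apply Rpower_pos_lt|apply exp_pos]. Qed.

Lemma Gamma_pos (x : R) : 0 < x -> 0 < Gamma x.
Proof.
intros Hx. apply Rlt_le_trans with (RInt (gamma_integrand x) 1 2).
- apply RInt_gt_0; [lra| |]; intros t Ht.
  + apply gamma_integrand_pos.
  + apply gamma_integrand_continuous. lra.
- apply is_RInt_gen_ge_RInt; try lra.
  + intros; now apply gamma_integrand_continuous.
  + intros; apply Rlt_le, gamma_integrand_pos.
  + now apply gamma_integrand_integrable.
Qed.

Lemma Rpower_lim_at_right_0 (x : R) : 0 < x ->
  filterlim (fun t => Rpower t x) (at_right 0) (locally 0).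
Proof.
intros Hx P [eps HP].
assert (He := cond_pos eps).
exists (mkposreal _ (Rpower_pos_lt eps (/ x))). intros t Ht Ht0. apply HP.
change (Rabs (t - 0) < Rpower eps (/ x)) in Ht. rewrite Rabs_right in Ht by lra.
change (Rabs (Rpower t x - 0) < eps).
assert (Hp := Rpower_pos_lt t x). rewrite Rabs_right by lra.
replace (eps : R) with (Rpower (Rpower eps (/ x)) x).
- rewrite Rminus_0_r. apply Rlt_Rpower_l; lra.
- rewrite Rpower_mult, Rinv_l, Rpower_1; lra.
Qed.

(** Squeezed below [K / t], by [Rpower_le_exp] with one extra power of [t]. *)
Lemma Rpower_exp_lim_infty (x : R) : 0 < x ->
  filterlim (fun t => Rpower t x * exp (- t)) (Rbar_locally p_infty) (locally 0).
Proof.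
intros Hx.
set (K := Rpower (x + 1) (x + 1) * exp 1).
assert (HK : 0 < K) by (apply Rmult_lt_0_compat; [apply Rpower_pos_lt|apply exp_pos]).
apply (is_lim_le_le_loc (fun _ => 0) (fun t => K / t) _ p_infty 0).
- exists 0. intros t Ht.
  assert (Hp := Rpower_pos_lt t x). assert (He := exp_pos (- t)). split.
  + apply Rlt_le, Rmult_lt_0_compat; lra.
  + apply (proj1 (Rle_div_r (Rpower t x * exp (- t)) K t Ht)). replace (Rpower t x * exp (- t) * t) with (Rpower t x * t * exp (- t)) by ring.
      replace (Rpower t x * t) with (Rpower t (x + 1)) by (rewrite Rpower_plus, Rpower_1; lra).
      apply Rle_trans with (Rpower (1 + t) (x + 1) * exp (- t)).
      * apply Rmult_le_compat_r; [lra|]. apply Rle_Rpower_l; lra.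
      * assert (H := Rpower_le_exp (x + 1) t ltac:(lra) Ht).
      apply Rmult_le_compat_r with (r := exp (- t)) in H; [|lra].
      rewrite exp_plus in H. unfold K.
      assert (exp t * exp (- t) = 1) by (rewrite <- exp_plus, Rplus_opp_r; apply exp_0).
      apply (Rle_trans _ _ _ H). right.
      transitivity (Rpower (x + 1) (x + 1) * exp 1 * (exp t * exp (- t))); [ring|].
      rewrite H0. ring.
- apply is_lim_const.
- replace (Finite 0) with (Rbar_div K p_infty) by (simpl; f_equal; ring).
  apply is_lim_div; [apply is_lim_const|apply is_lim_id|discriminate|exact I].
Qed.

(** Integration by parts, read as the improper integral of the derivative of [- t^x exp (- t)],
    whose boundary values both vanish. *)
Lemma Gamma_S (x : R) : 0 < x -> Gamma (x + 1) = x * Gamma x.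
Proof.
intros Hx.
assert (H : is_RInt_gen (fun t => gamma_integrand (x + 1) t - x * gamma_integrand x t)
  (at_right 0) (Rbar_locally p_infty) (- 0 - - 0)).
{ apply (is_RInt_gen_antiderivative (fun t => - (Rpower t x * exp (- t)))).
  - intros t Ht. unfold gamma_integrand.
    replace (x + 1 - 1) with x by ring. replace (x - 1) with (x + - (1)) by ring.
    rewrite Rpower_plus, Rpower_Ropp, Rpower_1 by lra.
    unfold Rpower. auto_derive; [lra|]. field. lra.
  - intros t Ht. apply (continuous_minus (V := R_NormedModule)).
    + now apply gamma_integrand_continuous.
    + apply (continuous_scal_r (V := R_NormedModule) x (gamma_integrand x)). now apply gamma_integrand_continuous.
  - apply (filterlim_comp _ _ _ _ Ropp _ (locally 0)); [|apply (filterlim_opp (V := R_NormedModule) 0)].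
    apply filterlim_ext_loc with (fun t => mult (Rpower t x) (exp (- t))); [now apply filter_forall|].
    replace 0 with (mult 0 (exp (- 0)) : R) at 2 by (unfold mult; simpl; ring).
    eapply filterlim_comp_2; [now apply Rpower_lim_at_right_0| |].
    + apply (filterlim_at_right_continuous (fun t => exp (- t))).
      apply (ex_derive_continuous (V := R_NormedModule) (fun t => exp (- t))). auto_derive. exact I.
    + apply (filterlim_mult (K := R_AbsRing) 0 (exp (- 0))).
  - apply (filterlim_comp _ _ _ _ Ropp _ (locally 0)); [|apply (filterlim_opp (V := R_NormedModule) 0)].
    now apply Rpower_exp_lim_infty. }
assert (H1 := gamma_integrand_integrable (x + 1) ltac:(lra)).
assert (H2 := is_RInt_gen_scal _ x _ (gamma_integrand_integrable x Hx)).
assert (H3 := is_RInt_gen_minus _ _ _ _ H1 H2).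
assert (H4 := is_RInt_gen_unique _ _ H). assert (H5 := is_RInt_gen_unique _ _ H3).
change (RInt_gen (fun t => gamma_integrand (x + 1) t - x * gamma_integrand x t)
  (at_right 0) (Rbar_locally p_infty) = Gamma (x + 1) - x * Gamma x) in H5.
lra.
Qed.

Lemma Gamma_1 : Gamma 1 = 1.
Proof.
replace 1 with (- 0 - - 1) at 2 by ring.
apply is_Gamma_unique.
apply (is_RInt_gen_antiderivative (fun t => - exp (- t))).
- intros t Ht. unfold gamma_integrand. replace (1 - 1) with 0 by ring.
  rewrite Rpower_O by lra. auto_derive; [exact I|ring].
- intros; now apply gamma_integrand_continuous.
- replace (-1) with (- exp (- 0)) by (rewrite Ropp_0, exp_0; reflexivity).
  apply (filterlim_at_right_continuous (fun t => - exp (- t))).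
  apply (ex_derive_continuous (V := R_NormedModule) (fun t => - exp (- t))).
  auto_derive. exact I.
- apply (filterlim_comp _ _ _ _ Ropp _ (locally 0)); [|apply (filterlim_opp (V := R_NormedModule) 0)].
  apply (is_lim_comp exp Ropp p_infty 0 m_infty).
  + apply is_lim_exp_m.
  + apply (is_lim_opp (fun t => t) p_infty p_infty). apply is_lim_id.
  + exists 0. discriminate.
Qed.

(** Cauchy-Schwarz, that is log-convexity of [Gamma] over half a unit: the integrand of [Gamma x]
    times [(1 + k t^(1/2))^2] has a nonnegative integral for every real [k]. *)
Lemma Gamma_half_sqr_le (x : R) : 0 < x ->
  Gamma (x + 1/2) ^ 2 <= Gamma x * Gamma (x + 1).
Proof.
intros Hx.
set (a := Gamma (x + 1)). set (b := Gamma (x + 1/2)). set (c := Gamma x).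
assert (Ha : 0 < a) by (apply Gamma_pos; lra).
assert (H : 0 <= c + (2 * (- (b / a)) * b + (b / a) ^ 2 * a)).
(* The minimiser of the quadratic [c + 2 k b + k^2 a]. *)
{ set (k := - (b / a)).
  set (f := fun t => gamma_integrand x t +
    (2 * k * gamma_integrand (x + 1/2) t + (b / a) ^ 2 * gamma_integrand (x + 1) t)).
  assert (Hf : forall t, 0 < t -> f t = gamma_integrand x t * (1 + k * Rpower t (1/2)) ^ 2).
  { intros t Ht. unfold f, gamma_integrand.
    replace (x + 1/2 - 1) with ((x - 1) + 1/2) by ring.
    replace (x + 1 - 1) with ((x - 1) + (1/2 + 1/2)) by field.
    rewrite !Rpower_plus. unfold k. ring. }
  apply Rle_trans with (RInt f 1 1); [rewrite RInt_point; apply Rle_refl|].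
  apply is_RInt_gen_ge_RInt; try lra.
  - intros t Ht. unfold f.
    apply (continuous_plus (V := R_NormedModule)); [now apply gamma_integrand_continuous|].
    apply (continuous_plus (V := R_NormedModule));
      apply (continuous_scal_r (V := R_NormedModule)); now apply gamma_integrand_continuous.
  - intros t Ht. rewrite Hf by lra. apply Rmult_le_pos; [apply Rlt_le, gamma_integrand_pos|].
    apply pow2_ge_0.
  - apply (is_RInt_gen_plus (V := R_NormedModule)); [apply gamma_integrand_integrable; lra|].
    apply (is_RInt_gen_plus (V := R_NormedModule));
      apply (is_RInt_gen_scal (V := R_NormedModule)); apply gamma_integrand_integrable; lra. }
apply Rmult_le_compat_r with (r := a) in H; [|lra].
rewrite Rmult_0_l in H.
replace ((c + (2 * - (b / a) * b + (b / a) ^ 2 * a)) * a) with (c * a - b ^ 2) in H by (field; lra).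
lra.
Qed.

(** * Asymptotics of Gamma ratios *)

(** Log-convexity at [x] gives the upper bound and at [x - 1/2] the lower one, after [Gamma_S]
    removes the unit shifts. *)
Lemma Gamma_half_sqr_bounds (x : R) : 1 / 2 < x ->
  x - 1 / 2 <= (Gamma (x + 1/2) / Gamma x) ^ 2 <= x.
Proof.
intros Hx.
assert (Hp := Gamma_pos x ltac:(lra)).
assert (H1 := Gamma_half_sqr_le x ltac:(lra)).
assert (H2 := Gamma_half_sqr_le (x - 1/2) ltac:(lra)).
rewrite (Gamma_S x) in H1 by lra.
replace (x - 1/2 + 1/2) with x in H2 by ring.
assert (H3 := Gamma_S (x - 1/2) ltac:(lra)).
replace (x - 1/2 + 1) with (x + 1/2) in H2, H3 by field.
assert (H0 : 0 < Gamma x ^ 2) by (apply pow_lt; lra).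
replace ((Gamma (x + 1/2) / Gamma x) ^ 2) with (Gamma (x + 1/2) ^ 2 / Gamma x ^ 2)
  by (field; lra).
split.
- apply Rle_div_r; [exact H0|].
  apply Rle_trans with ((x - 1/2) * (Gamma (x - 1/2) * Gamma (x + 1/2))).
  + apply Rmult_le_compat_l; lra.
  + rewrite <- Rmult_assoc, <- H3. right; ring.
- apply Rle_div_l; [exact H0|]. simpl in *; lra.
Qed.

Lemma is_lim_seq_1_of_sqr (u : nat -> R) :
  (forall n, 0 < u n) -> is_lim_seq (fun n => u n ^ 2) 1 -> is_lim_seq u 1.
Proof.
intros Hu H. rewrite <- sqrt_1.
apply is_lim_seq_ext with (fun n => sqrt (u n ^ 2)).
{ intros n. apply sqrt_pow2. now apply Rlt_le. }
apply is_lim_seq_continuous; [|exact H].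
apply continuity_pt_sqrt. lra.
Qed.

Lemma is_lim_seq_ratio (a b c : R) : 0 < c ->
  is_lim_seq (fun n => (INR n * c + a) / (INR n * c + b)) 1.
Proof.
intros Hc.
apply is_lim_seq_ext_loc with (fun n => 1 + (a - b) * / (INR n * c + b)).
{ assert (H : is_lim_seq (fun n => INR n * c) p_infty).
  { replace p_infty with (Rbar_mult p_infty c).
    - apply is_lim_seq_scal_r, is_lim_seq_INR.
    - simpl. case Rle_dec; intros; [|lra]. case Rle_lt_or_eq_dec; intros; [reflexivity|lra]. }
  destruct (H (fun y => - b < y)) as [N HN]; [now exists (- b)|].
  exists N. intros n Hn. specialize (HN n Hn). field. lra. }
replace (Finite 1) with (Rbar_plus 1 (Rbar_mult (a - b) 0)) by (simpl; f_equal; ring).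
apply is_lim_seq_plus'; [apply is_lim_seq_const|].
replace ((a - b) * 0) with (real (Rbar_mult (a - b) 0)) by (simpl; ring).
apply (is_lim_seq_scal_l _ _ (Finite 0)).
replace (Finite 0) with (Rbar_inv p_infty) by reflexivity.
apply is_lim_seq_inv; [|discriminate].
replace p_infty with (Rbar_plus p_infty b) by reflexivity.
apply is_lim_seq_plus with p_infty b; [|apply is_lim_seq_const|reflexivity].
replace p_infty with (Rbar_mult p_infty c).
- apply is_lim_seq_scal_r, is_lim_seq_INR.
- simpl. case Rle_dec; intros; [|lra]. case Rle_lt_or_eq_dec; intros; [reflexivity|lra].
Qed.

(** * Wallis integrals and the value of [Gamma] at 1/2 *)

Definition wallis (n : nat) : R := RInt (fun t => cos t ^ n) 0 (PI / 2).

Lemma ex_RInt_cos_pow (n : nat) : ex_RInt (fun t => cos t ^ n) 0 (PI / 2).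
Proof.
apply (ex_RInt_continuous (V := R_CompleteNormedModule)). intros t _.
apply (ex_derive_continuous (V := R_NormedModule)). auto_derive. exact I.
Qed.

Lemma wallis_pos (n : nat) : 0 < wallis n.
Proof.
assert (HP := PI_RGT_0).
apply RInt_gt_0; [lra| |].
- intros t Ht. apply pow_lt, cos_gt_0; lra.
- intros t _. apply (ex_derive_continuous (V := R_NormedModule)). auto_derive. exact I.
Qed.

Lemma wallis_S_le (n : nat) : wallis (S n) <= wallis n.
Proof.
assert (HP := PI_RGT_0).
apply RInt_le; [lra|apply ex_RInt_cos_pow|apply ex_RInt_cos_pow|].
intros t Ht. simpl. assert (H := COS_bound t).
assert (0 <= cos t ^ n) by (apply pow_le, Rlt_le, cos_gt_0; lra). nra.
Qed.

(** The difference of the two integrands is the derivative of [sin t * cos t ^ (n + 1)], which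
    vanishes at 0 and at [PI / 2]. *)
Lemma wallis_SS (n : nat) : INR (n + 2) * wallis (S (S n)) = INR (n + 1) * wallis n.
Proof.
assert (H : is_RInt (fun t => INR (n + 2) * cos t ^ S (S n) - INR (n + 1) * cos t ^ n)
  0 (PI / 2) (sin (PI / 2) * cos (PI / 2) ^ S n - sin 0 * cos 0 ^ S n)).
{ apply (is_RInt_derive (fun t => sin t * cos t ^ S n)).
  - intros t _. auto_derive; [exact I|].
    change (match n with 0%nat => 1 | S _ => INR n + 1 end) with (INR (S n)).
    replace (INR (S n)) with (INR (n + 1)) by (f_equal; lia).
    replace (INR (n + 2)) with (INR (n + 1) + 1) by (rewrite !plus_INR; simpl; ring).
    cbn [pow]. assert (H := sin2_cos2 t). unfold Rsqr in H.
    transitivity (cos t * (cos t * cos t ^ n) - sin t * sin t * (INR (n + 1) * cos t ^ n)); [cbn [Init.Nat.pred]; ring|].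
    replace (sin t * sin t) with (1 - cos t * cos t) by lra. ring.
  - intros t _. apply (ex_derive_continuous (V := R_NormedModule)). auto_derive. repeat split. }
assert (H1 : is_RInt (fun t => INR (n + 2) * cos t ^ S (S n) - INR (n + 1) * cos t ^ n)
  0 (PI / 2) (INR (n + 2) * wallis (S (S n)) - INR (n + 1) * wallis n)).
{ apply (is_RInt_minus (V := R_NormedModule));
    apply (is_RInt_scal (V := R_NormedModule));
    apply (RInt_correct (V := R_CompleteNormedModule)), ex_RInt_cos_pow. }
apply (is_RInt_unique (V := R_CompleteNormedModule)) in H.
apply (is_RInt_unique (V := R_CompleteNormedModule)) in H1.
rewrite H1 in H. rewrite sin_0, cos_PI2 in H. simpl in H. lra.
Qed.

Lemma wallis_0 : wallis 0 = PI / 2.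
Proof. unfold wallis; simpl. rewrite RInt_const. unfold scal; simpl; unfold mult; simpl. ring. Qed.

Lemma wallis_1 : wallis 1 = 1.
Proof.
unfold wallis.
transitivity (sin (PI / 2) - sin 0); [|rewrite sin_0, sin_PI2; ring].
apply (is_RInt_unique (V := R_CompleteNormedModule)).
apply (is_RInt_derive sin (fun t => cos t ^ 1)).
- intros t _. auto_derive; [exact I|ring].
- intros t _. apply (ex_derive_continuous (V := R_NormedModule)). auto_derive. exact I.
Qed.

(** Monotonicity puts [wallis (S n)] between [wallis (S (S n))] and [wallis n], whose ratio is
    [(n + 1) / (n + 2)]. *)
Lemma is_lim_seq_wallis_ratio : is_lim_seq (fun n => wallis (S n) / wallis n) 1.
Proof.
apply is_lim_seq_le_le with (fun n => (INR n * 1 + 1) / (INR n * 1 + 2)) (fun _ => 1).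
- intros n. assert (H := wallis_pos n). assert (Hn := pos_INR n). split.
  + apply (Rle_div_r _ _ (wallis n)); [exact H|]. apply Rle_trans with (wallis (S (S n))); [|apply wallis_S_le].
    assert (H2 := wallis_SS n). rewrite !plus_INR in H2; simpl in H2.
    replace (wallis (S (S n))) with (/ (INR n + 2) * ((INR n + (1 + 1)) * wallis (S (S n))))
      by (field; lra).
    rewrite H2. right. field. lra.
  + apply Rle_div_l; [exact H|]. rewrite Rmult_1_l. apply wallis_S_le.
- apply is_lim_seq_ratio; lra.
- apply is_lim_seq_const.
Qed.

(* Two positive solutions of the same two-step recursion are proportional as soon as
   consecutive terms become asymptotically equal. *)
Lemma two_step_proportional (u v c : nat -> R) :
  (forall n, 0 < u n) -> (forall n, 0 < v n) ->
  (forall n, u (S (S n)) = c n * u n) -> (forall n, v (S (S n)) = c n * v n) ->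
  is_lim_seq (fun n => u (S n) / u n) 1 -> is_lim_seq (fun n => v (S n) / v n) 1 ->
  u 1%nat * v 0%nat = v 1%nat * u 0%nat.
Proof.
intros Hu Hv Hcu Hcv Lu Lv.
assert (Hr : forall k, u (2 * k)%nat * v 0%nat = v (2 * k)%nat * u 0%nat /\
  u (S (2 * k)) * v 1%nat = v (S (2 * k)) * u 1%nat).
{ induction k as [|k [IH1 IH2]]; [split; simpl; ring|].
  replace (2 * S k)%nat with (S (S (2 * k))) by lia.
  rewrite !Hcu, !Hcv. rewrite !Rmult_assoc, IH1, IH2. split; ring. }
assert (L : is_lim_seq (fun n => (u (S n) / u n) / (v (S n) / v n)) (1 / 1)).
{ apply is_lim_seq_div'; auto. }
assert (L2 : is_lim_seq (fun k => (u (S (2 * k)) / u (2 * k)%nat) / (v (S (2 * k)) / v (2 * k)%nat)) (1 / 1)).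
{ apply (is_lim_seq_subseq _ _ (fun k => (2 * k)%nat)) in L; [exact L|].
  apply eventually_subseq. intros; lia. }
(* Along even indices the quotient of the two ratios does not depend on [k], so its limit 1 is its
   value at [k = 0]. *)
apply is_lim_seq_ext with (v := fun _ => (u 1%nat * v 0%nat) / (v 1%nat * u 0%nat)) in L2.
- apply is_lim_seq_unique in L2. rewrite Lim_seq_const in L2. injection L2 as L2.
  generalize (Hu 0%nat) (Hv 1%nat); intros.
  apply Rmult_eq_reg_r with (/ (v 1%nat * u 0%nat)).
  + change (u 1%nat * v 0%nat / (v 1%nat * u 0%nat) = v 1%nat * u 0%nat / (v 1%nat * u 0%nat)).
    rewrite L2. field. lra.
  + apply Rinv_neq_0_compat. nra.
- intros k. destruct (Hr k) as [H1 H2].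
  generalize (Hu (2*k)%nat) (Hv (2*k)%nat) (Hu (S (2*k))) (Hv (S (2*k)))
    (Hu 0%nat) (Hv 0%nat) (Hu 1%nat) (Hv 1%nat); intros.
  replace (u (2 * k)%nat) with (v (2 * k)%nat * u 0%nat / v 0%nat) by (rewrite <- H1; field; lra).
  replace (u (S (2 * k))) with (v (S (2 * k)) * u 1%nat / v 1%nat) by (rewrite <- H2; field; lra).
  field. repeat split; lra.
Qed.

(** The quotients [g n] obey the two-step recursion of the Wallis integrals and their consecutive
    ratios tend to 1. Proportionality equates [g 1 / g 0 = 2 / Gamma (1/2) ^ 2] with
    [wallis 1 / wallis 0 = 2 / PI]. *)
Lemma Gamma_half : Gamma (1 / 2) = sqrt PI.
Proof.
set (g := fun n => Gamma ((INR n + 1) / 2) / Gamma (INR n / 2 + 1)).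
assert (Hg : forall n, 0 < g n).
{ intros n. assert (Hn := pos_INR n). apply Rdiv_lt_0_compat; apply Gamma_pos; lra. }
assert (H := two_step_proportional g wallis (fun n => (INR n + 1) / (INR n + 2)) Hg wallis_pos).
assert (G0 : 0 < Gamma (1/2)) by (apply Gamma_pos; lra).
enough (g 1%nat * wallis 0 = wallis 1 * g 0%nat) as E.
{ unfold g in E. rewrite wallis_0, wallis_1 in E. simpl in E.
  replace ((1 + 1) / 2) with 1 in E by field. replace ((0 + 1) / 2) with (1/2) in E by field.
  replace (0 / 2 + 1) with 1 in E by field. rewrite Gamma_S, Gamma_1 in E by lra.
  symmetry. apply sqrt_lem_1; [apply Rlt_le, PI_RGT_0|lra|].
  apply Rmult_eq_reg_r with (/ Gamma (1/2)); [|apply Rinv_neq_0_compat; lra].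
  replace (PI * / Gamma (1/2)) with (1 / (1 / 2 * Gamma (1 / 2)) * (PI / 2)) by (field; lra).
  rewrite E. field. lra. }
apply H; clear H.
- intros n. assert (Hn := pos_INR n). unfold g. rewrite !S_INR.
  replace ((INR n + 1 + 1 + 1) / 2) with ((INR n + 1) / 2 + 1) by field.
  replace ((INR n + 1 + 1) / 2 + 1) with (INR n / 2 + 1 + 1) by field.
  rewrite !(Gamma_S (_ / 2)), (Gamma_S (INR n / 2 + 1)) by lra.
  assert (0 < Gamma (INR n / 2 + 1)) by (apply Gamma_pos; lra).
  assert (Q : Gamma (INR n / 2 + 1) <> 0) by lra. field. lra.
- intros n. assert (H := wallis_SS n). rewrite !plus_INR in H. simpl in H.
  assert (Hn := pos_INR n).
  apply Rmult_eq_reg_l with (INR n + (1 + 1)); [|lra]. rewrite H. field. lra.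
- apply is_lim_seq_le_le with (fun n => (INR n * 1 + 0) / (INR n * 1 + 1)) (fun _ => 1).
  + intros n. assert (Hn := pos_INR n). unfold g. rewrite S_INR.
    set (x := (INR n + 1) / 2).
    replace ((INR n + 1 + 1) / 2) with (x + 1/2) by (unfold x; field).
    replace ((INR n + 1) / 2 + 1) with (x + 1) by (unfold x; field).
    replace (INR n / 2 + 1) with (x + 1/2) by (unfold x; field).
    assert (Hx : 1/2 <= x) by (unfold x; lra).
    rewrite Gamma_S by lra.
    assert (0 < Gamma x) by (apply Gamma_pos; lra).
    assert (0 < Gamma (x + 1/2)) by (apply Gamma_pos; lra).
    replace (Gamma (x + 1 / 2) / (x * Gamma x) / (Gamma x / Gamma (x + 1 / 2)))
      with ((Gamma (x + 1 / 2) / Gamma x) ^ 2 / x) by (field; lra).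
    destruct Hx as [Hx|Hx].
    * destruct (Gamma_half_sqr_bounds x Hx). split.
      -- replace ((INR n * 1 + 0) / (INR n * 1 + 1)) with ((x - 1/2) / x) by (unfold x; field; lra).
         apply Rmult_le_compat_r; [|lra]. apply Rlt_le, Rinv_0_lt_compat; lra.
      -- apply Rle_div_l; lra.
    (* For [n = 0], [x = 1/2] lies outside the range of [Gamma_half_sqr_bounds]; the required lower
       bound is then just 0. *)
    * assert (E : INR n = 0) by (unfold x in Hx; lra). rewrite E. split.
      -- replace ((0 * 1 + 0) / (0 * 1 + 1)) with 0 by field.
         apply Rlt_le, Rdiv_lt_0_compat; [|lra]. apply pow_lt, Rdiv_lt_0_compat; lra.
      -- apply Rle_div_l; [lra|].
         replace ((Gamma (x + 1/2) / Gamma x) ^ 2) with (Gamma (x + 1/2) ^ 2 / Gamma x ^ 2)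
           by (field; lra).
         apply Rle_div_l; [apply pow_lt; lra|].
         assert (Q := Gamma_half_sqr_le x ltac:(lra)). rewrite Gamma_S in Q by lra. simpl in *. lra.
  + apply is_lim_seq_ratio; lra.
  + apply is_lim_seq_const.
- apply is_lim_seq_wallis_ratio.
Qed.

(** * The moments [m_n] and their asymptotics *)

Definition bs_moment (nu : R) (n : nat) : R := INR (fact (S n)) * BS_coef nu n.

(** The extra factor [n + 1] in [(n + 1)!] is absorbed by [Gamma ((n + 3) / 2) = (n + 1) / 2 * Gamma
    ((n + 1) / 2)]; hence the 2 in front. *)
Lemma bs_moment_eq (nu : R) (n : nat) : -1 < nu ->
  bs_moment nu n = 2 * Gamma (nu + 1) / sqrt PI *
    (Gamma ((INR n + 3) / 2) / Gamma (INR n / 2 + nu + 1)).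
Proof.
intros Hnu. assert (Hn := pos_INR n). unfold bs_moment, BS_coef.
replace ((INR n + 3) / 2) with ((INR n + 1) / 2 + 1) by field. rewrite (Gamma_S ((INR n + 1) / 2)) by lra.
change (fact (S n)) with (S n * fact n)%nat. rewrite mult_INR, S_INR.
assert (Gamma (INR n / 2 + nu + 1) <> 0) by (apply Rgt_not_eq, Rlt_gt, Gamma_pos; lra).
assert (INR (fact n) <> 0) by apply INR_fact_neq_0.
assert (sqrt PI <> 0) by apply Rgt_not_eq, sqrt_lt_R0, PI_RGT_0.
field. auto.
Qed.

Lemma bs_moment_pos (nu : R) (n : nat) : -1 < nu -> 0 < bs_moment nu n.
Proof.
intros Hnu. assert (Hn := pos_INR n). rewrite bs_moment_eq by lra.
assert (0 < sqrt PI) by apply sqrt_lt_R0, PI_RGT_0.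
apply Rmult_lt_0_compat; apply Rdiv_lt_0_compat; try lra;
  [apply Rmult_lt_0_compat; [lra|]| |]; apply Gamma_pos; lra.
Qed.

Lemma bs_moment_0 (nu : R) : -1 < nu -> bs_moment nu 0 = 1.
Proof.
intros Hnu. unfold bs_moment, BS_coef. simpl.
replace ((0 + 1) / 2) with (1 / 2) by field. rewrite Gamma_half.
replace (0 / 2 + nu + 1) with (nu + 1) by field.
assert (Gamma (nu + 1) <> 0) by (apply Rgt_not_eq, Rlt_gt, Gamma_pos; lra).
assert (sqrt PI <> 0) by apply Rgt_not_eq, sqrt_lt_R0, PI_RGT_0.
field. auto.
Qed.

Lemma bs_moment_SS (nu : R) (n : nat) : -1 < nu ->
  bs_moment nu (S (S n)) = (INR n + 3) / (INR n + (2 * nu + 2)) * bs_moment nu n.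
Proof.
intros Hnu. assert (Hn := pos_INR n). rewrite !bs_moment_eq by lra. rewrite !S_INR.
replace ((INR n + 1 + 1 + 3) / 2) with ((INR n + 3) / 2 + 1) by field.
replace ((INR n + 1 + 1) / 2 + nu + 1) with (INR n / 2 + nu + 1 + 1) by field.
rewrite (Gamma_S ((INR n + 3) / 2)), (Gamma_S (INR n / 2 + nu + 1)) by lra.
assert (Gamma (INR n / 2 + nu + 1) <> 0) by (apply Rgt_not_eq, Rlt_gt, Gamma_pos; lra).
assert (sqrt PI <> 0) by apply Rgt_not_eq, sqrt_lt_R0, PI_RGT_0.
field. repeat split; auto; lra.
Qed.

(** The ratio is [Gamma (x + 1/2) / Gamma x] at [x = (n + 3) / 2] divided by the same expression at
    [y = n / 2 + nu + 1]. The available bounds concern squares, and the hypothesis on [nu] is what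
    makes [y > 1/2]. *)
Lemma is_lim_seq_bs_moment_ratio (nu : R) : - (1 / 2) < nu ->
  is_lim_seq (fun n => bs_moment nu (S n) / bs_moment nu n) 1.
Proof.
intros Hnu. apply is_lim_seq_1_of_sqr.
{ intros n. apply Rdiv_lt_0_compat; apply bs_moment_pos; lra. }
apply is_lim_seq_le_le with (fun n => (INR n * 1 + 2) / (INR n * 1 + (2 * nu + 2)))
  (fun n => (INR n * 1 + 3) / (INR n * 1 + (2 * nu + 1))).
- intros n. assert (Hn := pos_INR n). rewrite !bs_moment_eq by lra. rewrite S_INR.
  set (x := (INR n + 3) / 2). set (y := INR n / 2 + nu + 1).
  replace ((INR n + 1 + 3) / 2) with (x + 1/2) by (unfold x; field).
  replace ((INR n + 1) / 2 + nu + 1) with (y + 1/2) by (unfold y; field).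
  destruct (Gamma_half_sqr_bounds x) as [X1 X2]; [unfold x; lra|].
  destruct (Gamma_half_sqr_bounds y) as [Y1 Y2]; [unfold y; lra|].
  set (Rx := (Gamma (x + 1/2) / Gamma x) ^ 2) in *.
  set (Ry := (Gamma (y + 1/2) / Gamma y) ^ 2) in *.
  assert (Hy : 0 < y - 1/2) by (unfold y; lra).
  replace ((_ / _) ^ 2) with (Rx / Ry).
  + replace ((INR n * 1 + 2) / (INR n * 1 + (2 * nu + 2))) with ((x - 1/2) / y)
      by (unfold x, y; field; lra).
    replace ((INR n * 1 + 3) / (INR n * 1 + (2 * nu + 1))) with (x / (y - 1/2))
      by (unfold x, y; field; lra).
    split; unfold Rdiv; apply Rmult_le_compat; try lra.
    * unfold x; lra.
    * apply Rlt_le, Rinv_0_lt_compat; lra.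
    * apply Rinv_le_contravar; lra.
    * unfold x in X1; lra.
    * apply Rlt_le, Rinv_0_lt_compat; lra.
    * apply Rinv_le_contravar; lra.
  + unfold Rx, Ry.
    assert (Gamma x <> 0) by (apply Rgt_not_eq, Gamma_pos; unfold x; lra).
    assert (Gamma y <> 0) by (apply Rgt_not_eq, Gamma_pos; unfold y; lra).
    assert (Gamma (x + 1/2) <> 0) by (apply Rgt_not_eq, Gamma_pos; unfold x; lra).
    assert (Gamma (y + 1/2) <> 0) by (apply Rgt_not_eq, Gamma_pos; unfold y; lra).
    assert (Gamma (nu + 1) <> 0) by (apply Rgt_not_eq, Rlt_gt, Gamma_pos; lra).
    assert (sqrt PI <> 0) by apply Rgt_not_eq, sqrt_lt_R0, PI_RGT_0.
    field. repeat split; auto.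
- apply is_lim_seq_ratio; lra.
- apply is_lim_seq_ratio; lra.
Qed.

(** * A positive functional on power series *)

(** This is [m_(n+2k) / m_(n+2k+2)] divided by its value at [n = 0], and equals
    [c * (1 + (2 nu - 1) / (n + 2k + 3))] with [c] independent of [n]. *)
Definition moment_factor (nu : R) (k n : nat) : R :=
  ((INR n + INR (2 * k) + (2 * nu + 2)) * (INR (2 * k) + 3)) /
  ((INR n + INR (2 * k) + 3) * (INR (2 * k) + (2 * nu + 2))).

Fixpoint moment_prod (nu : R) (N n : nat) : R :=
  match N with
  | O => 1
  | S N' => moment_prod nu N' n * moment_factor nu N' n
  end.

Lemma moment_factor_bounds (nu : R) (k n : nat) : 1 / 2 <= nu ->
  0 < moment_factor nu k n <= 1.
Proof.
intros Hnu. unfold moment_factor. assert (Hn := pos_INR n). assert (Hk := pos_INR (2 * k)).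
assert (0 < (INR n + INR (2 * k) + 3) * (INR (2 * k) + (2 * nu + 2))) by (apply Rmult_lt_0_compat; lra).
split.
- apply Rdiv_lt_0_compat; [|assumption]. apply Rmult_lt_0_compat; lra.
- apply Rle_div_l; [assumption|]. nra.
Qed.

Lemma moment_prod_bounds (nu : R) (N n : nat) : 1 / 2 <= nu ->
  0 < moment_prod nu N n <= 1.
Proof.
intros Hnu. induction N as [|N IH]; simpl; [lra|].
assert (H := moment_factor_bounds nu N n Hnu). nra.
Qed.

(** The product telescopes; the remaining quotient tends to 1 as [N] grows. *)
Lemma bs_moment_prod (nu : R) (N n : nat) : -1 < nu ->
  bs_moment nu n =
  moment_prod nu N n * (bs_moment nu (n + 2 * N) / bs_moment nu (2 * N)).
Proof.
intros Hnu. induction N as [|N IH].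
- simpl (2 * 0)%nat. rewrite Nat.add_0_r, bs_moment_0 by lra. simpl. field.
- rewrite IH. cbn [moment_prod].
  replace (n + 2 * S N)%nat with (S (S (n + 2 * N))) by lia.
  replace (2 * S N)%nat with (S (S (2 * N))) by lia.
  rewrite !bs_moment_SS by lra. unfold moment_factor.
  rewrite (plus_INR n). assert (Hn := pos_INR n). assert (Hk := pos_INR (2 * N)).
  assert (bs_moment nu (2 * N) <> 0) by (apply Rgt_not_eq, Rlt_gt, bs_moment_pos; lra).
  field. repeat split; try assumption; lra.
Qed.

Lemma is_lim_seq_moment_prod (nu : R) (n : nat) : - (1 / 2) < nu ->
  is_lim_seq (fun N => moment_prod nu N n) (bs_moment nu n).
Proof.
intros Hnu.
assert (H : is_lim_seq (fun N => bs_moment nu (n + 2 * N) / bs_moment nu (2 * N)) 1).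
(* The quotient is a product of [n] consecutive ratios, each tending to 1. *)
{ induction n as [|n IH].
  - apply is_lim_seq_ext with (fun _ => 1); [|apply is_lim_seq_const].
    intros N. simpl. field. apply Rgt_not_eq, Rlt_gt, bs_moment_pos; lra.
  - apply is_lim_seq_ext with (fun N =>
      bs_moment nu (S (n + 2 * N)) / bs_moment nu (n + 2 * N)
      * (bs_moment nu (n + 2 * N) / bs_moment nu (2 * N))).
    { intros N. simpl (S n + 2 * N)%nat.
      assert (0 < bs_moment nu (2 * N)) by (apply bs_moment_pos; lra).
      assert (0 < bs_moment nu (n + 2 * N)) by (apply bs_moment_pos; lra).
      simpl in *. field. lra. }
    replace 1 with (1 * 1) by ring. apply is_lim_seq_mult'; [|exact IH].
    apply (is_lim_seq_subseq (fun k => bs_moment nu (S k) / bs_moment nu k) 1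
      (fun N => (n + 2 * N)%nat)); [apply eventually_subseq; intros; lia|].
    now apply is_lim_seq_bs_moment_ratio. }
apply is_lim_seq_ext with (fun N =>
  bs_moment nu n / (bs_moment nu (n + 2 * N) / bs_moment nu (2 * N))).
{ intros N. rewrite (bs_moment_prod nu N n) at 1 by lra.
  assert (0 < bs_moment nu (2 * N)) by (apply bs_moment_pos; lra).
  assert (0 < bs_moment nu (n + 2 * N)) by (apply bs_moment_pos; lra).
  field. lra. }
enough (L : is_lim_seq (fun N =>
  bs_moment nu n / (bs_moment nu (n + 2 * N) / bs_moment nu (2 * N))) (bs_moment nu n / 1)).
{ now rewrite Rdiv_1_r in L. }
apply (is_lim_seq_div' _ _ (bs_moment nu n) 1); [apply is_lim_seq_const|exact H|lra].
Qed.

Lemma bs_moment_le_1 (nu : R) (n : nat) : 1 / 2 <= nu -> bs_moment nu n <= 1.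
Proof.
intros Hnu.
apply (is_lim_seq_le (fun N => moment_prod nu N n) (fun _ => 1) (bs_moment nu n) 1).
- intros N. apply moment_prod_bounds, Hnu.
- apply is_lim_seq_moment_prod. lra.
- apply is_lim_seq_const.
Qed.

(** A class of entire series that is stable under bounded multipliers and has absolute convergence
    at [t = 1], where the functionals are evaluated. *)
Definition exp_dominated (p : nat -> R) : Prop :=
  exists K, forall n, Rabs (p n) <= K / INR (fact n).

Lemma ex_series_inv_fact : ex_series (fun n => / INR (fact n)).
Proof.
exists (exp 1). assert (H := is_exp_Reals 1).
apply is_pseries_R in H. revert H. apply is_series_ext.
intros n. rewrite pow1. apply Rmult_1_r.
Qed.

Lemma exp_dominated_CV_radius (p : nat -> R) :
  exp_dominated p -> CV_radius p = p_infty.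
Proof.
intros [K HK]. assert (H := CV_radius_bounded p). destruct H as [H _].
assert (Hb : forall r : R, Rbar_le r (CV_radius p)).
{ intros r. apply H.
  assert (He := is_exp_Reals (Rabs r)). apply is_pseries_R in He.
  assert (Hl := ex_series_lim_0 _ (ex_intro _ _ He)).
  destruct (filterlim_bounded (V := R_NormedModule) _ (ex_intro _ 0 Hl)) as [M HM].
  assert (HK0 : 0 <= K).
  { specialize (HK 0%nat). simpl in HK. assert (Q := Rabs_pos (p 0%nat)). lra. }
  exists (K * M). intros n. rewrite Rabs_mult, <- RPow_abs.
  apply Rle_trans with (K / INR (fact n) * Rabs r ^ n).
  - apply Rmult_le_compat_r; [apply pow_le, Rabs_pos|apply HK].
  - unfold Rdiv. rewrite Rmult_assoc. apply Rmult_le_compat_l; auto.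
    eapply Rle_trans; [apply Rle_abs|apply HM]. }
destruct (CV_radius p) as [r| |]; auto.
- specialize (Hb (r + 1)). simpl in Hb. lra.
- specialize (Hb 0). now simpl in Hb.
Qed.

Lemma exp_dominated_le (p q : nat -> R) :
  exp_dominated p -> (forall n, Rabs (q n) <= Rabs (p n)) -> exp_dominated q.
Proof. intros [K HK] H. exists K. intros n. eapply Rle_trans; [apply H|apply HK]. Qed.

Lemma exp_dominated_ex_series (p : nat -> R) :
  exp_dominated p -> ex_series (fun n => Rabs (p n)).
Proof.
intros [K HK]. apply (ex_series_le (V := R_CompleteNormedModule) _ (fun n => K / INR (fact n))).
- intros n. unfold norm; simpl. unfold abs; simpl. rewrite Rabs_Rabsolu. apply HK.
- apply (ex_series_scal_l (V := R_NormedModule) K (fun n => / INR (fact n))), ex_series_inv_fact.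
Qed.

(* [q n = p n / (n + j + 1)] is the coefficientwise form of
   [t ^ (j + 1) * q t] having derivative [t ^ j * p t]. *)
Lemma PSeries_div_ge_0 (p : nat -> R) (j : nat) : exp_dominated p ->
  (forall t, 0 <= t <= 1 -> 0 <= PSeries p t) ->
  forall t, 0 <= t <= 1 -> 0 <= PSeries (fun n => p n / (INR n + INR (S j))) t.
Proof.
intros Hp Hpos t Ht.
set (q := fun n => p n / (INR n + INR (S j))).
assert (Hj : forall n, 1 <= INR n + INR (S j)).
{ intros n. rewrite S_INR. assert (H1 := pos_INR n). assert (H2 := pos_INR j). lra. }
assert (Hq : exp_dominated q).
{ apply exp_dominated_le with p; [exact Hp|]. intros n. unfold q, Rdiv. rewrite Rabs_mult.
  rewrite <- (Rmult_1_r (Rabs (p n))) at 2. apply Rmult_le_compat_l; [apply Rabs_pos|].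
  rewrite Rabs_right; [|apply Rle_ge, Rlt_le, Rinv_0_lt_compat; specialize (Hj n); lra].
  rewrite <- Rinv_1. apply Rinv_le_contravar; [lra|apply Hj]. }
assert (Cp := exp_dominated_CV_radius p Hp). assert (Cq := exp_dominated_CV_radius q Hq).
destruct (Rle_lt_or_eq_dec 0 t (proj1 Ht)) as [Ht0|<-].
(* At [t = 0] one cannot divide by [t ^ (j + 1)]; there the value is [p 0 / (j + 1)]. *)
2:{ rewrite PSeries_0. unfold q. specialize (Hj 0%nat).
    specialize (Hpos 0 ltac:(lra)). rewrite PSeries_0 in Hpos.
    apply Rmult_le_pos; [exact Hpos|]. apply Rlt_le, Rinv_0_lt_compat; lra. }
assert (HD : forall s, is_derive (fun s => s ^ S j * PSeries q s) s (s ^ j * PSeries p s)).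
{ intros s.
  assert (E : PSeries p s = INR (S j) * PSeries q s + s * PSeries (PS_derive q) s).
  { rewrite <- PSeries_incr_1, <- PSeries_scal, <- PSeries_plus.
    - apply PSeries_ext. intros n. unfold PS_plus, PS_scal, PS_incr_1, PS_derive, q.
      specialize (Hj n). set (c := INR (S j)) in *.
      destruct n as [|n]; [simpl in Hj; change zero with 0|]; unfold plus, scal; simpl;
        unfold mult; simpl; try change (match n with 0%nat => 1 | S _ => INR n + 1 end) with (INR (S n));
        field; simpl in *; lra.
    - apply ex_pseries_scal; [apply Rmult_comm|]. apply CV_radius_inside. now rewrite Cq.
    - apply ex_pseries_incr_1, CV_radius_inside. rewrite CV_radius_derive. now rewrite Cq. }
  rewrite E.
  evar_last.
  - apply (is_derive_mult (fun s => s ^ S j) (PSeries q) s).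
    + apply (is_derive_pow (fun s => s) (S j) s 1). apply (is_derive_id (K := R_AbsRing)).
    + apply is_derive_PSeries. now rewrite Cq.
    + intros; apply Rmult_comm.
  - unfold plus, mult; cbn [Init.Nat.pred]; simpl (_ ^ S j). cbn -[INR]. ring. }
(* Since [t ^ (j + 1) * q t] vanishes at 0, it equals [c ^ j * p c * t] for some [c] in [0, t]. *)
destruct (MVT_gen (fun s => s ^ S j * PSeries q s) 0 t (fun s => s ^ j * PSeries p s))
  as [c [Hc E]].
- intros s _. apply HD.
- intros s _. apply continuity_pt_filterlim.
  apply (ex_derive_continuous (V := R_NormedModule) (fun s => s ^ S j * PSeries q s)).
  eexists; apply HD.
- rewrite Rmin_left, Rmax_right in Hc by lra. rewrite pow_ne_zero, Rmult_0_l, Rminus_0_r in E by lia.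
  assert (H1 : 0 <= t ^ S j * PSeries q t).
  { rewrite E. apply Rmult_le_pos; [|lra]. apply Rmult_le_pos; [apply pow_le; lra|apply Hpos; lra]. }
  assert (H2 : 0 < t ^ S j) by (apply pow_lt; lra).
  apply Rmult_le_reg_l with (t ^ S j); [exact H2|]. now rewrite Rmult_0_r.
Qed.

(** The new series is [c * (p + (2 nu - 1) * q)] with [q] from [PSeries_div_ge_0] at [j = 2k + 2].
    Here [nu >= 1/2] makes the coefficient of [q] nonnegative. Domination is returned as well, so
    that the step can be iterated. *)
Lemma moment_factor_ge_0 (nu : R) (k : nat) (p : nat -> R) : 1 / 2 <= nu ->
  exp_dominated p -> (forall t, 0 <= t <= 1 -> 0 <= PSeries p t) ->
  exp_dominated (fun n => moment_factor nu k n * p n) /\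
  (forall t, 0 <= t <= 1 -> 0 <= PSeries (fun n => moment_factor nu k n * p n) t).
Proof.
intros Hnu Hp Hpos.
assert (Hk := pos_INR (2 * k)).
assert (HE : forall n, INR n + INR (S (2 * k + 2)) = INR n + INR (2 * k) + 3).
{ intros n. rewrite S_INR, plus_INR. simpl (INR 2). ring. }
split.
- apply exp_dominated_le with p; [exact Hp|]. intros n. rewrite Rabs_mult.
  destruct (moment_factor_bounds nu k n Hnu) as [H1 H2].
  rewrite (Rabs_right (moment_factor _ _ _)) by lra. assert (H := Rabs_pos (p n)). nra.
- intros t Ht.
  set (q := fun n => p n / (INR n + INR (S (2 * k + 2)))).
  assert (Hq : 0 <= PSeries q t) by (apply PSeries_div_ge_0; assumption).
  assert (Dq : exp_dominated q).
  { apply exp_dominated_le with p; [exact Hp|]. intros n. unfold q, Rdiv.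
    rewrite HE, Rabs_mult. assert (Hn := pos_INR n).
    rewrite (Rabs_right (/ _)) by (apply Rle_ge, Rlt_le, Rinv_0_lt_compat; lra).
    rewrite <- (Rmult_1_r (Rabs (p n))) at 2. apply Rmult_le_compat_l; [apply Rabs_pos|].
    rewrite <- Rinv_1. apply Rinv_le_contravar; lra. }
  set (c := (INR (2 * k) + 3) / (INR (2 * k) + (2 * nu + 2))).
  assert (Hc : 0 < c) by (apply Rdiv_lt_0_compat; lra).
  replace (PSeries (fun n => moment_factor nu k n * p n) t)
    with (c * (PSeries p t + (2 * nu - 1) * PSeries q t)).
  + apply Rmult_le_pos; [lra|]. specialize (Hpos t Ht). nra.
  + rewrite <- PSeries_scal, <- PSeries_plus, <- PSeries_scal.
    * apply PSeries_ext. intros n. unfold PS_scal, PS_plus, scal, plus; simpl. unfold mult; simpl.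
      unfold q, moment_factor, c. rewrite HE. assert (Hn := pos_INR n). simpl in *. field. lra.
    * apply CV_radius_inside. now rewrite exp_dominated_CV_radius.
    * apply ex_pseries_scal; [apply Rmult_comm|]. apply CV_radius_inside.
      now rewrite exp_dominated_CV_radius.
Qed.

(** Each induction step moves one factor from the product onto [p], so [p] must stay general; with
    no factor left the sum is the value of the series at [t = 1]. *)
Lemma moment_prod_series_ge_0 (nu : R) (N : nat) : 1 / 2 <= nu ->
  forall p, exp_dominated p -> (forall t, 0 <= t <= 1 -> 0 <= PSeries p t) ->
  0 <= Series (fun n => moment_prod nu N n * p n).
Proof.
intros Hnu. induction N as [|N IH]; intros p Hp Hpos.
- rewrite (Series_ext _ (fun n => p n * 1 ^ n)); [apply Hpos; lra|].
  intros n; simpl; rewrite pow1; ring.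
- rewrite (Series_ext _ (fun n => moment_prod nu N n * (moment_factor nu N n * p n)))
    by (intros n; simpl; ring).
  destruct (moment_factor_ge_0 nu N p Hnu Hp Hpos). now apply IH.
Qed.

(** Dominated convergence: the tails of [u N] and [v] are controlled by the tail of [b], and the
    finite head converges termwise. *)
Lemma Series_dominated_lim (u : nat -> nat -> R) (v b : nat -> R) :
  (forall N n, Rabs (u N n) <= b n) -> ex_series b ->
  (forall n, is_lim_seq (fun N => u N n) (v n)) ->
  is_lim_seq (fun N => Series (u N)) (Series v).
Proof.
intros Hu Hb Hv.
assert (Hvb : forall n, Rabs (v n) <= b n).
{ intros n. apply (is_lim_seq_le (fun N => Rabs (u N n)) (fun _ => b n) (Rabs (v n)) (b n)).
  - intros N; apply Hu.
  - apply is_lim_seq_abs with (l := Finite (v n)), Hv.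
  - apply is_lim_seq_const. }
assert (Eu : forall N, ex_series (u N)).
{ intros N. apply (ex_series_le (V := R_CompleteNormedModule) _ b); [apply Hu|exact Hb]. }
assert (Ev : ex_series v).
{ apply (ex_series_le (V := R_CompleteNormedModule) _ b); [apply Hvb|exact Hb]. }
assert (Htail : forall (w : nat -> R) M, (forall n, Rabs (w n) <= b n) ->
  Rabs (Series w - sum_f_R0 w M) <= Series b - sum_f_R0 b M).
{ intros w M Hw.
  assert (Ew : ex_series w).
  { apply (ex_series_le (V := R_CompleteNormedModule) _ b); [apply Hw|exact Hb]. }
  rewrite (Series_incr_n w (S M)), (Series_incr_n b (S M)) by (try lia; assumption).
  cbn [Init.Nat.pred].
  replace (_ + _ - sum_f_R0 w M) with (Series (fun k => w (S M + k)%nat)) by ring.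
  replace (_ + _ - sum_f_R0 b M) with (Series (fun k => b (S M + k)%nat)) by ring.
  assert (Ebt : ex_series (fun k => b (S M + k)%nat)) by (apply (ex_series_incr_n b), Hb).
  eapply Rle_trans; [apply Series_Rabs|apply Series_le; [|exact Ebt]].
  - apply (ex_series_le (V := R_CompleteNormedModule) _ (fun k => b (S M + k)%nat)); [|exact Ebt].
    intros n. unfold norm; simpl; unfold abs; simpl. rewrite Rabs_Rabsolu. apply Hw.
  - intros n. split; [apply Rabs_pos|apply Hw]. }
apply is_lim_seq_spec. intros eps.
assert (He : 0 < eps / 3) by (assert (H := cond_pos eps); lra).
assert (HM : exists M, Series b - sum_f_R0 b M < eps / 3).
{ assert (H := Series_correct _ Hb).
  destruct (H (fun y => Rabs (y - Series b) < eps / 3)) as [M HM].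
  { exists (mkposreal _ He). intros y Hy. exact Hy. }
  exists M. specialize (HM M (Nat.le_refl M)). rewrite sum_n_Reals in HM.
  apply Rabs_def2 in HM. lra. }
destruct HM as [M HM].
assert (Hfin : is_lim_seq (fun N => sum_f_R0 (u N) M) (sum_f_R0 v M)).
{ induction M as [|M' IHM] in |- *; simpl; [apply Hv|]. apply is_lim_seq_plus'; auto. }
apply is_lim_seq_spec in Hfin. destruct (Hfin (mkposreal _ He)) as [N0 HN0].
exists N0. intros N HN. specialize (HN0 N HN). simpl in HN0.
assert (H1 := Htail (u N) M (Hu N)). assert (H2 := Htail v M Hvb).
apply Rabs_def2 in HN0. apply Rabs_le_between in H1. apply Rabs_le_between in H2.
apply Rabs_def1; lra.
Qed.

Lemma bs_moment_series_ge_0 (nu : R) (p : nat -> R) : 1 / 2 <= nu ->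
  exp_dominated p -> (forall t, 0 <= t <= 1 -> 0 <= PSeries p t) ->
  0 <= Series (fun n => bs_moment nu n * p n).
Proof.
intros Hnu Hp Hpos.
apply (is_lim_seq_le (fun _ => 0) (fun N => Series (fun n => moment_prod nu N n * p n))
  0 (Series (fun n => bs_moment nu n * p n))).
- intros N. now apply moment_prod_series_ge_0.
- apply is_lim_seq_const.
- apply Series_dominated_lim with (fun n => Rabs (p n)).
  + intros N n. rewrite Rabs_mult. destruct (moment_prod_bounds nu N n Hnu) as [H1 H2].
    rewrite (Rabs_right (moment_prod _ _ _)) by lra. assert (H := Rabs_pos (p n)). nra.
  + now apply exp_dominated_ex_series.
  + intros n. apply is_lim_seq_mult'; [|apply is_lim_seq_const].
    apply is_lim_seq_moment_prod. lra.
Qed.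

(** * Exponential series *)

Lemma is_derive_0_const (f : R -> R) (t : R) :
  (forall s, is_derive f s 0) -> f t = f 0.
Proof.
intros H.
destruct (MVT_gen f 0 t (fun _ => 0)) as [c [_ E]]; [intros; apply H| |lra].
intros s _. apply continuity_pt_filterlim, (ex_derive_continuous (V := R_NormedModule) f).
exists 0. apply H.
Qed.

(** Coefficients, in the real variable [t], of the real and imaginary parts of [exp (z t)]. The
    functional acts on real series in [t], so [z] is a mere parameter. *)
Definition exp_re (z : C) (n : nat) : R := Re (z ^ n)%C / INR (fact n).
Definition exp_im (z : C) (n : nat) : R := Im (z ^ n)%C / INR (fact n).

Lemma im_le_Cmod (c : C) : Rabs (Im c) <= Cmod c.
Proof. eapply Rle_trans; [apply Rmax_r|apply Rmax_Cmod]. Qed.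

Lemma Cmod_pow_le_1 (z : C) (n : nat) : Cmod z <= 1 -> Cmod (z ^ n) <= 1.
Proof.
intros Hz. rewrite Cmod_pow. rewrite <- (pow1 n). apply pow_incr.
split; [apply Cmod_ge_0|exact Hz].
Qed.

Lemma exp_re_dominated (z : C) : Cmod z <= 1 -> exp_dominated (exp_re z).
Proof.
intros Hz. exists 1. intros n. unfold exp_re, Rdiv. rewrite Rabs_mult.
assert (H := Rinv_0_lt_compat _ (INR_fact_lt_0 n)).
rewrite (Rabs_right (/ _)) by lra. apply Rmult_le_compat_r; [lra|].
eapply Rle_trans; [apply re_le_Cmod|now apply Cmod_pow_le_1].
Qed.

Lemma exp_im_dominated (z : C) : Cmod z <= 1 -> exp_dominated (exp_im z).
Proof.
intros Hz. exists 1. intros n. unfold exp_im, Rdiv. rewrite Rabs_mult.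
assert (H := Rinv_0_lt_compat _ (INR_fact_lt_0 n)).
rewrite (Rabs_right (/ _)) by lra. apply Rmult_le_compat_r; [lra|].
eapply Rle_trans; [apply im_le_Cmod|now apply Cmod_pow_le_1].
Qed.

Lemma PSeries_lin2 (p q : nat -> R) (a b t : R) :
  exp_dominated p -> exp_dominated q ->
  PSeries (fun n => a * p n + b * q n) t = a * PSeries p t + b * PSeries q t.
Proof.
intros Hp Hq.
rewrite <- !PSeries_scal, <- PSeries_plus; [reflexivity| |];
  (apply ex_pseries_scal; [apply Rmult_comm|]; apply CV_radius_inside;
   now rewrite exp_dominated_CV_radius).
Qed.

(** Termwise differentiation gives [P' = x P - y Q] and [Q' = x Q + y P] with [P 0 = 1], [Q 0 = 0];
    this linear system determines [P] and [Q]. *)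
Lemma PSeries_exp_re_im (z : C) (t : R) : Cmod z <= 1 ->
  PSeries (exp_re z) t = exp (Re z * t) * cos (Im z * t) /\
  PSeries (exp_im z) t = exp (Re z * t) * sin (Im z * t).
Proof.
intros Hz. set (x := Re z). set (y := Im z).
set (P := PSeries (exp_re z)). set (Q := PSeries (exp_im z)).
assert (Dp := exp_re_dominated z Hz). assert (Dq := exp_im_dominated z Hz).
assert (HP : forall s, is_derive P s (x * P s - y * Q s)).
{ intros s. replace (x * P s - y * Q s) with (PSeries (PS_derive (exp_re z)) s).
  - apply is_derive_PSeries. now rewrite exp_dominated_CV_radius.
  - replace (x * P s - y * Q s) with (x * P s + (- y) * Q s) by ring.
    unfold P, Q. rewrite <- PSeries_lin2 by assumption. apply PSeries_ext. intros n.
    unfold PS_derive, exp_re, exp_im. rewrite Cpow_S, re_mult.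
    change (fact (S n)) with (S n * fact n)%nat. rewrite mult_INR.
    assert (INR (S n) <> 0) by (apply not_0_INR; lia). assert (Hf := INR_fact_neq_0 n).
    unfold x, y. field. auto. }
assert (HQ : forall s, is_derive Q s (x * Q s + y * P s)).
{ intros s. replace (x * Q s + y * P s) with (PSeries (PS_derive (exp_im z)) s).
  - apply is_derive_PSeries. now rewrite exp_dominated_CV_radius.
  - unfold P, Q. rewrite <- PSeries_lin2 by assumption. apply PSeries_ext. intros n.
    unfold PS_derive, exp_re, exp_im. rewrite Cpow_S, im_mult.
    change (fact (S n)) with (S n * fact n)%nat. rewrite mult_INR.
    assert (INR (S n) <> 0) by (apply not_0_INR; lia). assert (Hf := INR_fact_neq_0 n).
    unfold x, y. field. auto. }
assert (P0 : P 0 = 1) by (unfold P, exp_re; rewrite PSeries_0; simpl; field).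
assert (Q0 : Q 0 = 0) by (unfold Q, exp_im; rewrite PSeries_0; simpl; field).
assert (EP : forall s, ex_derive P s) by (intros s; eexists; apply HP).
assert (EQ : forall s, ex_derive Q s) by (intros s; eexists; apply HQ).
assert (DP : forall s, Derive (fun s => P s) s = x * P s - y * Q s) by (intros s; apply is_derive_unique, HP).
assert (DQ : forall s, Derive (fun s => Q s) s = x * Q s + y * P s) by (intros s; apply is_derive_unique, HQ).
(* [exp (- z t) * (P + i Q)] is constant. *)
assert (HU : exp (- (x * t)) * (P t * cos (y * t) + Q t * sin (y * t)) = 1).
{ rewrite (is_derive_0_const (fun s => exp (- (x * s)) * (P s * cos (y * s) + Q s * sin (y * s)))).
  - rewrite P0, Q0, !Rmult_0_r, Ropp_0, exp_0, cos_0, sin_0. ring.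
  - intros s. auto_derive; [repeat split; auto|]. rewrite DP, DQ. ring. }
assert (HV : exp (- (x * t)) * (Q t * cos (y * t) - P t * sin (y * t)) = 0).
{ rewrite (is_derive_0_const (fun s => exp (- (x * s)) * (Q s * cos (y * s) - P s * sin (y * s)))).
  - rewrite P0, Q0, !Rmult_0_r, Ropp_0, exp_0, cos_0, sin_0. ring.
  - intros s. auto_derive; [repeat split; auto|]. rewrite DP, DQ. ring. }
assert (He : exp (x * t) * exp (- (x * t)) = 1) by (rewrite <- exp_plus, Rplus_opp_r; apply exp_0).
assert (Hcs := sin2_cos2 (y * t)). unfold Rsqr in Hcs.
set (e := exp (x * t)) in *. set (e' := exp (- (x * t))) in *.
set (c := cos (y * t)) in *. set (d := sin (y * t)) in *.
split.
- transitivity ((e * e') * (d * d + c * c) * P t); [rewrite He, Hcs; ring|].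
  transitivity (e * (c * (e' * (P t * c + Q t * d)) - d * (e' * (Q t * c - P t * d)))); [ring|].
  rewrite HU, HV. ring.
- transitivity ((e * e') * (d * d + c * c) * Q t); [rewrite He, Hcs; ring|].
  transitivity (e * (d * (e' * (P t * c + Q t * d)) + c * (e' * (Q t * c - P t * d)))); [ring|].
  rewrite HU, HV. ring.
Qed.

(** Positivity is applied to [p - c]; since [m_0 = 1], the functional maps the constant [c] to [c].
    For the second bound, dividing by [n + 1] is first carried out on the series by
    [PSeries_div_ge_0] with [j = 0]. *)
Lemma bs_moment_series_ge (nu : R) (p : nat -> R) (c : R) : 1 / 2 <= nu ->
  exp_dominated p -> (forall t, 0 <= t <= 1 -> c <= PSeries p t) ->
  c <= Series (fun n => bs_moment nu n * p n) /\
  c <= Series (fun n => bs_moment nu n * (p n / (INR n + 1))).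
Proof.
intros Hnu Hp Hpos.
set (d := fun n => match n with O => c | S _ => 0 end).
assert (Hd : exp_dominated d).
{ exists (Rabs c). intros [|n]; simpl d; [simpl; right; field|].
  rewrite Rabs_R0. apply Rmult_le_pos; [apply Rabs_pos|].
  apply Rlt_le, Rinv_0_lt_compat, INR_fact_lt_0. }
assert (Sd : forall u : nat -> R, Series (fun n => u n * d n) = u O * c).
{ intros u.
  assert (Z : Series (fun k => u (S k) * d (S k)) = 0).
  { rewrite (Series_ext _ (fun _ => 0 * 0)) by (intros; simpl; ring).
    rewrite Series_scal_l. ring. }
  rewrite Series_incr_1, Z; [simpl; ring|].
  apply ex_series_incr_1. apply ex_series_ext with (fun _ => 0); [intros; simpl; symmetry; apply Rmult_0_r|].
  exists 0. apply (is_lim_seq_ext (fun _ => 0) _ 0); [|apply is_lim_seq_const].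
  intros n. rewrite sum_n_const. ring. }
assert (Pd : forall t, PSeries d t = c).
{ intros t. unfold PSeries. rewrite (Series_ext _ (fun n => t ^ n * d n)) by (intros; ring).
  rewrite Sd. simpl; ring. }
set (p' := fun n => 1 * p n + (-1) * d n).
assert (Hp' : exp_dominated p').
{ destruct Hp as [K HK], Hd as [K' HK']. exists (K + K'). intros n. unfold p'.
  eapply Rle_trans; [apply Rabs_triang|]. rewrite !Rabs_mult, Rabs_R1, (Rabs_left (-1)) by lra.
  specialize (HK n); specialize (HK' n).
  replace ((K + K') / INR (fact n)) with (K / INR (fact n) + K' / INR (fact n))
    by (field; apply INR_fact_neq_0). lra. }
assert (Pp' : forall t, 0 <= t <= 1 -> 0 <= PSeries p' t).
{ intros t Ht. unfold p'. rewrite PSeries_lin2, Pd by assumption. specialize (Hpos t Ht). lra. }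
assert (Hm0 : bs_moment nu 0 = 1) by (apply bs_moment_0; lra).
assert (Hm : forall n, 0 < bs_moment nu n <= 1).
{ intros n. split; [apply bs_moment_pos; lra|now apply bs_moment_le_1]. }
assert (Ex : forall (u q : nat -> R), (forall n, 0 < u n <= 1) -> exp_dominated q ->
  ex_series (fun n => u n * q n)).
{ intros u q Hu Hq. apply (ex_series_le (V := R_CompleteNormedModule) _ (fun n => Rabs (q n))).
  - intros n. unfold norm; simpl; unfold abs; simpl. rewrite Rabs_mult.
    specialize (Hu n). rewrite (Rabs_right (u n)) by lra. assert (H := Rabs_pos (q n)). nra.
  - now apply exp_dominated_ex_series. }
assert (Fin : forall u : nat -> R, (forall n, 0 < u n <= 1) -> u O = 1 ->
  0 <= Series (fun n => u n * p' n) -> c <= Series (fun n => u n * p n)).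
{ intros u Hu Hu0 H.
  rewrite (Series_ext _ (fun n => u n * p n - u n * d n)) in H by (intros n; unfold p'; ring).
  rewrite Series_minus, Sd, Hu0 in H by (now apply Ex). lra. }
assert (Hi : forall n, 0 < / (INR n + 1) <= 1).
{ intros n. assert (H := pos_INR n). split; [apply Rinv_0_lt_compat; lra|].
  rewrite <- Rinv_1 at 2. apply Rinv_le_contravar; lra. }
split.
- apply Fin; auto. now apply bs_moment_series_ge_0.
- rewrite (Series_ext _ (fun n => (bs_moment nu n * / (INR n + 1)) * p n))
    by (intros n; unfold Rdiv; ring).
  apply Fin.
  + intros n. specialize (Hm n); specialize (Hi n). nra.
  + rewrite Hm0. simpl. field.
  + rewrite (Series_ext _ (fun n => bs_moment nu n * (p' n / (INR n + INR 1))))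
      by (intros n; unfold Rdiv; simpl (INR 1); ring).
    apply bs_moment_series_ge_0; [assumption| |now apply PSeries_div_ge_0].
    apply exp_dominated_le with p'; [assumption|]. intros n. unfold Rdiv. rewrite Rabs_mult.
    simpl (INR 1). specialize (Hi n). rewrite (Rabs_right (/ _)) by lra.
    assert (H := Rabs_pos (p' n)). nra.
Qed.

Lemma Rabs_mult_le_1 (y t : R) : Rabs y <= 1 -> 0 <= t <= 1 -> -1 <= y * t <= 1.
Proof. intros Hy Ht. apply Rabs_le_between in Hy. nra. Qed.

(** Both [x t] and [y t] lie in [-1, 1], and [1 < PI / 2] keeps the cosine positive. *)
Lemma exp_cos_ge (x y t : R) : Rabs x <= 1 -> Rabs y <= 1 -> 0 <= t <= 1 ->
  exp (-1) * cos 1 <= exp (x * t) * cos (y * t).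
Proof.
intros Hx Hy Ht.
assert (H1 := Rabs_mult_le_1 x t Hx Ht). assert (H2 := Rabs_mult_le_1 y t Hy Ht).
assert (HP := PI2_1).
assert (HP2 : PI / 2 <= 2) by (generalize PI_4; lra).
assert (C1 : 0 < cos 1) by (apply cos_gt_0; lra).
apply Rmult_le_compat; [apply Rlt_le, exp_pos|lra| |].
- destruct (proj1 H1) as [H|H]; [left; now apply exp_increasing|rewrite H; apply Rle_refl].
- destruct (Rle_dec 0 (y * t)).
  + apply cos_decr_1; lra.
  + rewrite <- (cos_neg (y * t)). apply cos_decr_1; lra.
Qed.

(** The factor [y] turns a statement about signs into a nonnegativity, to which the positive
    functional applies. *)
Lemma mult_exp_sin_ge_0 (x y t : R) : Rabs y <= 1 -> 0 <= t <= 1 ->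
  0 <= y * (exp (x * t) * sin (y * t)).
Proof.
intros Hy Ht. assert (He := exp_pos (x * t)). assert (HP := PI2_1).
apply Rabs_le_between in Hy.
assert (0 <= y * sin (y * t)); [|nra].
destruct (Rle_dec 0 y).
- apply Rmult_le_pos; [lra|]. apply sin_ge_0; nra.
- replace (y * sin (y * t)) with ((- y) * sin ((- y) * t)).
  + apply Rmult_le_pos; [lra|]. apply sin_ge_0; nra.
  + replace ((- y) * t) with (- (y * t)) by ring. rewrite sin_neg. ring.
Qed.

Lemma bs_moment_exp_series (nu : R) (z : C) : 1 / 2 <= nu -> Cmod z <= 1 ->
  exp (-1) * cos 1 <= Series (fun n => bs_moment nu n * exp_re z n) /\
  exp (-1) * cos 1 <= Series (fun n => bs_moment nu n * (exp_re z n / (INR n + 1))) /\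
  0 <= Im z * Series (fun n => bs_moment nu n * exp_im z n) /\
  0 <= Im z * Series (fun n => bs_moment nu n * (exp_im z n / (INR n + 1))).
Proof.
intros Hnu Hz.
assert (Hx : Rabs (Re z) <= 1) by (eapply Rle_trans; [apply re_le_Cmod|exact Hz]).
assert (Hy : Rabs (Im z) <= 1) by (eapply Rle_trans; [apply im_le_Cmod|exact Hz]).
destruct (bs_moment_series_ge nu (exp_re z) (exp (-1) * cos 1) Hnu (exp_re_dominated z Hz))
  as [H1 H2].
{ intros t Ht. rewrite (proj1 (PSeries_exp_re_im z t Hz)). now apply exp_cos_ge. }
destruct (bs_moment_series_ge nu (fun n => Im z * exp_im z n) 0 Hnu) as [H3 H4].
{ destruct (exp_im_dominated z Hz) as [K HK]. exists (Rabs (Im z) * K). intros n.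
  rewrite Rabs_mult. unfold Rdiv. rewrite Rmult_assoc. apply Rmult_le_compat_l; [apply Rabs_pos|apply HK]. }
{ intros t Ht. change (0 <= PSeries (PS_scal (Im z) (exp_im z)) t).
  rewrite PSeries_scal, (proj2 (PSeries_exp_re_im z t Hz)). now apply mult_exp_sin_ge_0. }
split; [exact H1|split; [exact H2|]].
rewrite <- !Series_scal_l. split.
- erewrite Series_ext; [exact H3|]. intros n; simpl; ring.
- erewrite Series_ext; [exact H4|]. intros n; simpl; unfold Rdiv; ring.
Qed.

(** * A starlikeness criterion *)

(** Cutting [0, 1] into [N] equal steps leaves a total error [K / N]; [N] is chosen so that this is
    below the supposed gap. *)
Lemma increment_ge_of_local (phi : R -> R) (k K : R) :
  (forall s s', 0 <= s -> s <= s' -> s' <= 1 ->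
     (s' - s) * k - K * (s' - s) ^ 2 <= phi s' - phi s) ->
  k <= phi 1 - phi 0.
Proof.
intros H. apply Rnot_lt_le. intros Hlt. set (g := k - (phi 1 - phi 0)).
assert (Hg : 0 < g) by (unfold g; lra).
destruct (archimed_cor1 (g / (1 + Rabs K))) as [N [HN HN0]].
{ apply Rdiv_lt_0_compat; [exact Hg|]. assert (Q := Rabs_pos K). lra. }
assert (HNp : 0 < INR N) by (apply lt_0_INR; lia).
assert (Hi : forall i, (i <= N)%nat ->
  INR i * (k / INR N - K / INR N ^ 2) <= phi (INR i / INR N) - phi 0).
{ induction i as [|i IH]; intros Hi.
  - simpl. replace (0 / INR N) with 0 by (field; lra). lra.
  - specialize (IH ltac:(lia)).
    assert (Hle : INR (S i) <= INR N) by (apply le_INR; lia). rewrite S_INR in Hle |- *.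
    assert (Q := pos_INR i). assert (Q2 := Rinv_0_lt_compat _ HNp).
    specialize (H (INR i / INR N) ((INR i + 1) / INR N)).
    replace ((INR i + 1) / INR N - INR i / INR N) with (/ INR N) in H by (field; lra).
    assert (H' : / INR N * k - K * (/ INR N) ^ 2 <= phi ((INR i + 1) / INR N) - phi (INR i / INR N)).
    { apply H; unfold Rdiv.
      - apply Rmult_le_pos; lra.
      - apply Rmult_le_compat_r; lra.
      - apply Rle_trans with (INR N * / INR N); [apply Rmult_le_compat_r; lra|rewrite Rinv_r; lra]. }
    replace (K / INR N ^ 2) with (K * (/ INR N) ^ 2) in * by (field; lra).
    unfold Rdiv in *. lra. }
specialize (Hi N (Nat.le_refl N)).
replace (INR N / INR N) with 1 in Hi by (field; lra).
replace (INR N * (k / INR N - K / INR N ^ 2)) with (k - K * / INR N) in Hi by (field; lra).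
assert (Q := Rabs_pos K). assert (Q2 := Rle_abs K). assert (Q3 := Rinv_0_lt_compat _ HNp).
apply (Rmult_lt_compat_r (1 + Rabs K)) in HN; [|lra].
replace (g / (1 + Rabs K) * (1 + Rabs K)) with g in HN by (field; lra).
unfold g in HN. nra.
Qed.

(** All constants are uniform on the open disk. [sd_quad] encodes that [df] is the derivative of
    [f], with a uniform remainder. [sd_radial] is a division-free, quantitative form of
    [Re (z f' / f) > 0], as [f / z = B]. *)
Record starlike_data (f df B : C -> C) (m K : R) : Prop := {
  sd_pos : 0 < m;
  sd_fun : forall z, f z = (z * B z)%C;
  sd_quad : forall z w, Cmod z < 1 -> Cmod w < 1 ->
    Cmod (f w - f z - (w - z) * df z) <= K * Cmod (w - z) ^ 2;
  sd_df_re : forall z, Cmod z < 1 -> m <= Re (df z);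
  sd_df_le : forall z, Cmod z < 1 -> Cmod (df z) <= K;
  sd_B_le : forall z, Cmod z < 1 -> Cmod (B z) <= K;
  sd_radial : forall z, Cmod z < 1 -> m <= Re (B z * Cconj (df z))
}.

Lemma Cmod_segment_lt (z w : C) (r s : R) : Cmod z < r -> Cmod w < r -> 0 <= s <= 1 ->
  Cmod (z + RtoC s * (w - z)) < r.
Proof.
intros Hz Hw Hs.
replace (z + RtoC s * (w - z))%C with (RtoC (1 - s) * z + RtoC s * w)%C
  by (rewrite RtoC_minus; ring).
eapply Rle_lt_trans; [apply Cmod_triangle|]. rewrite !Cmod_mult, !Cmod_R, !Rabs_right by lra.
destruct (Rle_lt_or_eq_dec 0 s (proj1 Hs)) as [H|<-]; [|lra].
assert (s * Cmod w < s * r) by (apply Rmult_lt_compat_l; lra).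
assert ((1 - s) * Cmod z <= (1 - s) * r) by (apply Rmult_le_compat_l; lra). lra.
Qed.

(** A quantitative Noshiro-Warschawski argument: along the segment with direction [d], the function
    [Re (conj(d) f)] has derivative [|d|^2 Re f']. *)
Lemma strongly_monotone f df B m K (S : starlike_data f df B m K) (z w : C) :
  Cmod z < 1 -> Cmod w < 1 ->
  m * Cmod (w - z) ^ 2 <= Re (Cconj (w - z) * (f w - f z)).
Proof.
intros Hz Hw. set (d := (w - z)%C).
set (phi := fun s : R => Re (Cconj d * f (z + RtoC s * d)%C)%C).
assert (H : m * Cmod d ^ 2 <= phi 1 - phi 0).
(* One factor [Cmod d] comes from [Cconj d], two from the quadratic remainder. *)
{ apply increment_ge_of_local with (K * Cmod d ^ 3). intros s s' H0 H1 H2.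
  set (u := (z + RtoC s * d)%C). set (u' := (z + RtoC s' * d)%C).
  assert (Hu : Cmod u < 1) by (apply Cmod_segment_lt; auto; lra).
  assert (Hu' : Cmod u' < 1) by (apply Cmod_segment_lt; auto; lra).
  assert (Hd : (u' - u)%C = (RtoC (s' - s) * d)%C).
  { unfold u, u'. rewrite RtoC_minus. ring. }
  assert (Q := sd_quad _ _ _ _ _ S u u' Hu Hu'). rewrite Hd in Q.
  set (E := (f u' - f u - RtoC (s' - s) * d * df u)%C) in Q.
  rewrite Cmod_mult, Cmod_R, Rabs_right in Q by lra.
  assert (HE : Rabs (Re (Cconj d * E)) <= Cmod d * (K * ((s' - s) * Cmod d) ^ 2)).
  { eapply Rle_trans; [apply re_le_Cmod|]. rewrite Cmod_mult, Cmod_conj.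
    apply Rmult_le_compat_l; [apply Cmod_ge_0|exact Q]. }
  assert (Hre := sd_df_re _ _ _ _ _ S u Hu).
  assert (Ex : phi s' - phi s = (s' - s) * (Cmod d ^ 2 * Re (df u)) + Re (Cconj d * E)).
  { unfold phi. fold u u'. rewrite Cmod2_alt. unfold E.
    destruct d, (f u), (f u'), (df u). simpl. ring. }
  rewrite Ex. apply Rabs_le_between in HE.
  assert (0 <= Cmod d ^ 2) by apply pow2_ge_0.
  assert (0 <= (s' - s) * Cmod d ^ 2 * (Re (df u) - m)) by (apply Rmult_le_pos; [apply Rmult_le_pos; [lra|assumption]|lra]).
  simpl in *. nra. }
unfold phi in H.
replace (z + RtoC 1 * d)%C with w in H by (unfold d; ring).
replace (z + RtoC 0 * d)%C with z in H by ring.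
eapply Rle_trans; [exact H|]. right. destruct d, (f w), (f z). simpl. ring.
Qed.

Lemma expansive f df B m K (S : starlike_data f df B m K) (z w : C) :
  Cmod z < 1 -> Cmod w < 1 -> m * Cmod (w - z) <= Cmod (f w - f z).
Proof.
intros Hz Hw. assert (H := strongly_monotone _ _ _ _ _ S z w Hz Hw).
assert (H1 := re_le_Cmod (Cconj (w - z) * (f w - f z))).
rewrite Cmod_mult, Cmod_conj in H1.
destruct (Rle_lt_or_eq_dec 0 (Cmod (w - z)) (Cmod_ge_0 _)) as [Hp|Hp].
- apply Rmult_le_reg_l with (Cmod (w - z)); [exact Hp|].
  apply Rle_trans with (m * Cmod (w - z) ^ 2); [right; ring|].
  eapply Rle_trans; [exact H|]. eapply Rle_trans; [apply Rle_abs|exact H1].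
- rewrite <- Hp, Rmult_0_r. apply Cmod_ge_0.
Qed.

Lemma univalent f df B m K (S : starlike_data f df B m K) (z w : C) :
  Cmod z < 1 -> Cmod w < 1 -> f z = f w -> z = w.
Proof.
intros Hz Hw E. assert (H := expansive _ _ _ _ _ S z w Hz Hw).
replace (f w - f z)%C with (RtoC 0) in H by (rewrite E; ring). rewrite Cmod_0 in H.
assert (Hm := sd_pos _ _ _ _ _ S). assert (Hc := Cmod_ge_0 (w - z)).
assert (Z : Cmod (w - z) = 0) by nra.
apply Cmod_eq_0 in Z. replace w with (z + (w - z))%C by ring. rewrite Z. ring.
Qed.

(** The 3 is 1 from the bound on [df] plus 2, the diameter of the disk, from the quadratic
    remainder. *)
Lemma lipschitz f df B m K (S : starlike_data f df B m K) (z w : C) :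
  Cmod z < 1 -> Cmod w < 1 -> Cmod (f w - f z) <= 3 * K * Cmod (w - z).
Proof.
intros Hz Hw. assert (H := sd_quad _ _ _ _ _ S z w Hz Hw).
assert (HK := sd_df_le _ _ _ _ _ S z Hz).
replace (f w - f z)%C with ((f w - f z - (w - z) * df z) + (w - z) * df z)%C by ring.
eapply Rle_trans; [apply Cmod_triangle|]. rewrite Cmod_mult.
assert (Hd : Cmod (w - z) <= 2).
{ eapply Rle_trans; [apply Cmod_triangle|]. rewrite Cmod_opp. lra. }
assert (H0 := Cmod_ge_0 (w - z)). assert (H1 := Cmod_ge_0 (df z)).
assert (Cmod (w - z) * Cmod (df z) <= Cmod (w - z) * K) by (apply Rmult_le_compat_l; lra).
assert (K * Cmod (w - z) ^ 2 <= 2 * K * Cmod (w - z)); [|lra].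
replace (K * Cmod (w - z) ^ 2) with (K * Cmod (w - z) * Cmod (w - z)) by ring.
assert (0 <= K * Cmod (w - z)) by (apply Rmult_le_pos; lra). nra.
Qed.

Lemma Cmod_le_Rabs (z : C) : Cmod z <= Rabs (Re z) + Rabs (Im z).
Proof.
replace z with (RtoC (Re z) + RtoC (Im z) * Ci)%C at 1.
- eapply Rle_trans; [apply Cmod_triangle|]. rewrite Cmod_mult, !Cmod_R, Cmod_Ci. lra.
- destruct z; unfold RtoC, Ci, Cplus, Cmult; simpl; f_equal; ring.
Qed.

Lemma C_cauchy_lim (w : nat -> C) (b : nat -> R) :
  is_lim_seq b 0 -> (forall n k, Cmod (w n - w k) <= b n + b k) ->
  exists l, is_lim_seq (fun n => Cmod (l - w n)) 0.
Proof.
intros Hb Hw.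
assert (HC : forall g : C -> R, (forall x y, g (x - y)%C = g x - g y) ->
  (forall x, Rabs (g x) <= Cmod x) -> ex_finite_lim_seq (fun n => g (w n))).
{ intros g Hlin Hg. apply ex_lim_seq_cauchy_corr. intros eps.
  apply is_lim_seq_spec in Hb.
  assert (He : 0 < eps / 2) by (assert (Q := cond_pos eps); lra).
  destruct (Hb (mkposreal _ He)) as [N HN]. exists N. intros n k Hn Hk.
  rewrite <- Hlin. eapply Rle_lt_trans; [apply Hg|]. eapply Rle_lt_trans; [apply Hw|].
  apply HN in Hn. apply HN in Hk. simpl in Hn, Hk. apply Rabs_def2 in Hn. apply Rabs_def2 in Hk. lra. }
destruct (HC Re) as [a Ha]; [intros [] []; reflexivity|apply re_le_Cmod|].
destruct (HC Im) as [c Hc]; [intros [] []; reflexivity|apply im_le_Cmod|].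
exists (a, c).
apply is_lim_seq_le_le with (fun _ => 0) (fun n => Rabs (a - Re (w n)) + Rabs (c - Im (w n))).
- intros n. split; [apply Cmod_ge_0|]. eapply Rle_trans; [apply Cmod_le_Rabs|].
  destruct (w n). apply Rle_refl.
- apply is_lim_seq_const.
- replace 0 with (Rabs (a - a) + Rabs (c - c)) by (rewrite !Rminus_diag, Rabs_R0; ring).
  apply is_lim_seq_plus';
    apply (is_lim_seq_abs _ (Finite (_ - _))); apply is_lim_seq_minus'; auto using is_lim_seq_const.
Qed.

(** Expansiveness makes [w] a Cauchy sequence, [r < 1] keeps its limit inside the open disk, and the
    Lipschitz bound identifies the value there. *)
Lemma range_closed f df B m K (S : starlike_data f df B m K) (w : nat -> C) (r : R) (tau : C) :
  r < 1 -> (forall n, Cmod (w n) <= r) -> is_lim_seq (fun n => Cmod (f (w n) - tau)) 0 ->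
  exists l, Cmod l < 1 /\ f l = tau.
Proof.
intros Hr Hw Hlim. assert (Hm := sd_pos _ _ _ _ _ S).
assert (Hw1 : forall n, Cmod (w n) < 1) by (intros n; specialize (Hw n); lra).
destruct (C_cauchy_lim w (fun n => Cmod (f (w n) - tau) * / m)) as [l Hl].
- replace 0 with (0 * / m) by ring. apply is_lim_seq_mult'; [exact Hlim|apply is_lim_seq_const].
- intros n k. assert (H := expansive _ _ _ _ _ S (w k) (w n) (Hw1 k) (Hw1 n)).
  apply Rmult_le_reg_l with m; [exact Hm|]. eapply Rle_trans; [exact H|].
  replace (f (w n) - f (w k))%C with ((f (w n) - tau) + - (f (w k) - tau))%C by ring.
  eapply Rle_trans; [apply Cmod_triangle|]. rewrite Cmod_opp. right. field. lra.
- assert (Hlr : Cmod l <= r).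
  { rewrite <- (Rplus_0_r r).
    apply (is_lim_seq_le (fun _ => Cmod l) (fun n => r + Cmod (l - w n)) (Cmod l) (r + 0)).
    - intros n. replace l with (w n + (l - w n))%C at 1 by ring.
      eapply Rle_trans; [apply Cmod_triangle|]. specialize (Hw n). lra.
    - apply is_lim_seq_const.
    - apply is_lim_seq_plus'; [apply is_lim_seq_const|exact Hl]. }
  exists l. split; [lra|].
  assert (Z : Cmod (f l - tau) <= 0).
  { apply (is_lim_seq_le (fun _ => Cmod (f l - tau))
      (fun n => 3 * K * Cmod (l - w n) + Cmod (f (w n) - tau)) (Cmod (f l - tau)) 0).
    - intros n. replace (f l - tau)%C with ((f l - f (w n)) + (f (w n) - tau))%C by ring.
      eapply Rle_trans; [apply Cmod_triangle|]. apply Rplus_le_compat_r.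
      apply (lipschitz _ _ _ _ _ S); auto. lra.
    - apply is_lim_seq_const.
    - replace 0 with (3 * K * 0 + 0) by ring. apply is_lim_seq_plus'; [|exact Hlim].
      apply is_lim_seq_mult'; [apply is_lim_seq_const|exact Hl]. }
  assert (Z' : Cmod (f l - tau) = 0) by (generalize (Cmod_ge_0 (f l - tau)); lra).
  apply Cmod_eq_0 in Z'. replace (f l) with ((f l - tau) + tau)%C by ring. rewrite Z'. ring.
Qed.

(* Explicit Euler step for the flow [w' = - f w / f' w], along which [f w] shrinks
   towards 0 on its ray and [Cmod w] decreases. *)
Definition euler_step (df B : C -> C) (h : R) (w : C) : C :=
  (w * (1 - RtoC h * (B w / df w)))%C.

(** With [q = B w / df w], [|1 - h q| <= 1] amounts to [h |q|^2 <= 2 Re q] for [h > 0]. As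
    [|q| <= K / m] and [Re q >= m / K^2], the condition [h K^4 <= 2 m^3] suffices. The linear part
    of the change of [f] is [- h w q f' w = - h f w], leaving only the quadratic remainder. *)
Lemma euler_step_spec f df B m K (S : starlike_data f df B m K) (h : R) (w : C) :
  Cmod w < 1 -> 0 <= h -> h * K ^ 4 <= 2 * m ^ 3 ->
  Cmod (euler_step df B h w) <= Cmod w /\
  Cmod (f (euler_step df B h w) - RtoC (1 - h) * f w) <= K * (K / m) ^ 2 * h ^ 2.
Proof.
intros Hw Hh Hh2. assert (Hm := sd_pos _ _ _ _ _ S).
set (q := (B w / df w)%C). unfold euler_step; fold q.
assert (Hre := sd_df_re _ _ _ _ _ S w Hw). assert (HdK := sd_df_le _ _ _ _ _ S w Hw).
assert (HB := sd_B_le _ _ _ _ _ S w Hw). assert (HR := sd_radial _ _ _ _ _ S w Hw).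
assert (Hdm : m <= Cmod (df w)).
{ eapply Rle_trans; [exact Hre|]. eapply Rle_trans; [apply Rle_abs|apply re_le_Cmod]. }
assert (Hd0 : df w <> 0%C) by (intros E; rewrite E, Cmod_0 in Hdm; lra).
assert (Hq : Cmod q <= K / m).
{ unfold q. rewrite Cmod_div by exact Hd0. unfold Rdiv. apply Rmult_le_compat.
  - apply Cmod_ge_0.
  - apply Rlt_le, Rinv_0_lt_compat. lra.
  - exact HB.
  - apply Rinv_le_contravar; lra. }
assert (HK0 : 0 < K) by lra.
assert (Hqre : m / K ^ 2 <= Re q).
{ assert (E : q = (RtoC (/ Cmod (df w) ^ 2) * (B w * Cconj (df w)))%C).
  { unfold q. rewrite RtoC_inv by (apply pow_nonzero; lra).
    rewrite Cmod2_conj. field. split; [|exact Hd0].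
    intros E. apply (f_equal Cmod) in E. rewrite Cmod_conj, Cmod_0 in E. lra. }
  rewrite E, re_scal_l. unfold Rdiv. rewrite Rmult_comm.
  apply Rmult_le_compat; try lra.
  - apply Rlt_le, Rinv_0_lt_compat, pow_lt; lra.
  - apply Rinv_le_contravar; [apply pow_lt; lra|]. apply pow_incr; lra. }
assert (Hq2 : Cmod q ^ 2 <= (K / m) ^ 2) by (apply pow_incr; split; [apply Cmod_ge_0|exact Hq]).
assert (Hstep : Cmod (1 - RtoC h * q) <= 1).
{ apply Rsqr_incr_0_var; [|lra]. rewrite !Rsqr_pow2, Cmod2_alt.
  replace (Re (1 - RtoC h * q) ^ 2 + Im (1 - RtoC h * q) ^ 2)
    with (1 - 2 * h * Re q + h ^ 2 * (Re q ^ 2 + Im q ^ 2)) by (destruct q; simpl; ring).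
  rewrite <- Cmod2_alt.
  assert (h * (K / m) ^ 2 <= 2 * (m / K ^ 2)).
  { replace (h * (K / m) ^ 2) with (h * K ^ 4 * / (m ^ 2 * K ^ 2)) by (field; lra).
    replace (2 * (m / K ^ 2)) with (2 * m ^ 3 * / (m ^ 2 * K ^ 2)) by (field; lra).
    apply Rmult_le_compat_r; [|exact Hh2].
    apply Rlt_le, Rinv_0_lt_compat, Rmult_lt_0_compat; apply pow_lt; lra. }
  assert (h * Cmod q ^ 2 <= 2 * Re q) by nra. nra. }
assert (Hle : Cmod (w * (1 - RtoC h * q)) <= Cmod w).
{ rewrite Cmod_mult. assert (Q := Cmod_ge_0 w). nra. }
split; [exact Hle|].
assert (Q := sd_quad _ _ _ _ _ S w (w * (1 - RtoC h * q))%C Hw ltac:(lra)).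
replace (w * (1 - RtoC h * q) - w)%C with (- (RtoC h * w * q))%C in Q by ring.
replace (f (w * (1 - RtoC h * q)) - f w - - (RtoC h * w * q) * df w)%C
  with (f (w * (1 - RtoC h * q)) - RtoC (1 - h) * f w)%C in Q.
- eapply Rle_trans; [exact Q|]. rewrite Cmod_opp, !Cmod_mult, Cmod_R, Rabs_right by lra.
  replace (K * (K / m) ^ 2 * h ^ 2) with (K * (h ^ 2 * (K / m) ^ 2)) by ring.
  apply Rmult_le_compat_l; [lra|].
  rewrite !Rpow_mult_distr.
  assert (Cmod w ^ 2 <= 1) by (rewrite <- (pow1 2); apply pow_incr; split; [apply Cmod_ge_0|lra]).
  assert (0 <= Cmod w ^ 2) by apply pow2_ge_0. assert (0 <= Cmod q ^ 2) by apply pow2_ge_0.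
  assert (0 <= h ^ 2) by apply pow2_ge_0.
  rewrite Rmult_assoc. apply Rmult_le_compat_l; [assumption|]. nra.
- rewrite (sd_fun _ _ _ _ _ S w), RtoC_minus. unfold q. field. exact Hd0.
Qed.

(** Earlier errors are multiplied by [1 - h], which lies in [0, 1], so the local errors at most add
    up. *)
Lemma euler_iter_spec f df B m K (S : starlike_data f df B m K) (h : R) (z : C) (k : nat) :
  Cmod z < 1 -> 0 <= h <= 1 -> h * K ^ 4 <= 2 * m ^ 3 ->
  Cmod (Nat.iter k (euler_step df B h) z) <= Cmod z /\
  Cmod (f (Nat.iter k (euler_step df B h) z) - RtoC ((1 - h) ^ k) * f z)
    <= INR k * (K * (K / m) ^ 2 * h ^ 2).
Proof.
intros Hz Hh Hh2. induction k as [|k [IH1 IH2]].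
- simpl Nat.iter. split; [lra|]. simpl pow.
  replace (f z - RtoC 1 * f z)%C with (RtoC 0) by ring. rewrite Cmod_0. simpl; lra.
- simpl Nat.iter. set (w := Nat.iter k (euler_step df B h) z) in *.
  destruct (euler_step_spec _ _ _ _ _ S h w) as [H1 H2]; [lra|lra|assumption|].
  split; [lra|].
  replace (f (euler_step df B h w) - RtoC ((1 - h) ^ Datatypes.S k) * f z)%C with
    ((f (euler_step df B h w) - RtoC (1 - h) * f w)
     + RtoC (1 - h) * (f w - RtoC ((1 - h) ^ k) * f z))%C
    by (simpl pow; rewrite RtoC_mult; ring).
  eapply Rle_trans; [apply Cmod_triangle|]. rewrite Cmod_mult, Cmod_R, Rabs_right by lra.
  rewrite S_INR. assert (Q := Cmod_ge_0 (f w - RtoC ((1 - h) ^ k) * f z)). nra.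
Qed.

Lemma exp_pow_INR (u : R) (n : nat) : exp u ^ n = exp (INR n * u).
Proof.
induction n as [|n IH]; [simpl; now rewrite Rmult_0_l, exp_0|].
rewrite S_INR, Rmult_plus_distr_r, Rmult_1_l, exp_plus, <- IH. simpl. ring.
Qed.

Lemma starlike_image f df B m K (S : starlike_data f df B m K) (z : C) (t : R) :
  Cmod z < 1 -> 0 <= t <= 1 -> exists w, Cmod w < 1 /\ f w = (RtoC t * f z)%C.
Proof.
intros Hz Ht. assert (Hm := sd_pos _ _ _ _ _ S).
destruct (Rle_lt_or_eq_dec 0 t (proj1 Ht)) as [Ht0|<-].
2:{ exists (RtoC 0). rewrite Cmod_0. split; [lra|]. rewrite (sd_fun _ _ _ _ _ S). ring. }
(* The time at which the exact flow has scaled [f] by [t]. *)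
set (L := - ln t).
assert (HL : 0 <= L).
{ unfold L. destruct (proj2 Ht) as [H|H].
  - assert (Q := ln_increasing _ _ Ht0 H). rewrite ln_1 in Q. lra.
  - rewrite H, ln_1. lra. }
assert (HK : 0 < K).
{ assert (H1 := sd_df_re _ _ _ _ _ S z Hz). assert (H2 := sd_df_le _ _ _ _ _ S z Hz).
  assert (H3 := re_le_Cmod (df z)). assert (H4 := Rle_abs (Re (df z))). lra. }
assert (HK4 : 0 < K ^ 4) by (apply pow_lt; lra). assert (Hm3 : 0 < m ^ 3) by (apply pow_lt; lra).
(* Starting beyond [N0] meets the step-size condition of [euler_step_spec] for every [n]. *)
destruct (nfloor_ex (L * K ^ 4 / (2 * m ^ 3))) as [N0 [_ HN0]].
{ apply Rmult_le_pos; [apply Rmult_le_pos; lra|]. apply Rlt_le, Rinv_0_lt_compat; lra. }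
set (N := fun n => (n + Datatypes.S N0)%nat).
(* This step makes [(1 - h) ^ N] exactly [t]; since [h <= L / N], the accumulated error is of order
   [1 / N]. *)
set (h := fun n => 1 - exp (- (L / INR (N n)))).
assert (HNpos : forall n, 0 < INR (N n)) by (intros n; apply lt_0_INR; unfold N; lia).
assert (Hh : forall n, 0 <= h n <= L / INR (N n)).
{ intros n. unfold h. assert (H1 := exp_ineq1_le (- (L / INR (N n)))).
  split; [|lra]. assert (0 <= L / INR (N n)).
  { apply Rmult_le_pos; [lra|]. apply Rlt_le, Rinv_0_lt_compat, HNpos. }
  assert (exp (- (L / INR (N n))) <= exp 0); [|rewrite exp_0 in *; lra].
  destruct H as [H|H]; [left; apply exp_increasing; lra|right; rewrite <- H; f_equal; ring]. }
assert (Hh1 : forall n, h n <= 1).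
{ intros n. unfold h. assert (Q := exp_pos (- (L / INR (N n)))). lra. }
assert (Hsmall : forall n, h n * K ^ 4 <= 2 * m ^ 3).
{ intros n. apply Rle_trans with (L / INR (N n) * K ^ 4); [apply Rmult_le_compat_r; [lra|apply Hh]|].
  assert (HNn : L * K ^ 4 / (2 * m ^ 3) <= INR (N n)).
  { unfold N. rewrite plus_INR, S_INR. assert (Q := pos_INR n). lra. }
  apply Rle_div_l in HNn; [|lra]. specialize (HNpos n).
  replace (L / INR (N n) * K ^ 4) with (L * K ^ 4 / INR (N n)) by (field; lra).
  apply Rle_div_l; lra. }
set (w := fun n => Nat.iter (N n) (euler_step df B (h n)) z).
apply (range_closed _ _ _ _ _ S w (Cmod z)); [exact Hz| |].
- intros n. apply (euler_iter_spec _ _ _ _ _ S); auto. specialize (Hh n); specialize (Hh1 n); lra.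
- apply is_lim_seq_le_le with (fun _ => 0) (fun n => K * (K / m) ^ 2 * L ^ 2 * / INR (N n)).
  + intros n. split; [apply Cmod_ge_0|].
    destruct (euler_iter_spec _ _ _ _ _ S (h n) z (N n)) as [_ H]; auto.
    { specialize (Hh n); specialize (Hh1 n); lra. }
    assert (Et : (1 - h n) ^ N n = t).
    { unfold h. replace (1 - (1 - exp (- (L / INR (N n))))) with (exp (- (L / INR (N n)))) by ring.
      rewrite exp_pow_INR. replace (INR (N n) * - (L / INR (N n))) with (ln t).
      - now apply exp_ln.
      - specialize (HNpos n). unfold L. field. lra. }
    rewrite Et in H. fold (w n) in H. eapply Rle_trans; [exact H|].
    apply Rle_trans with (INR (N n) * (K * (K / m) ^ 2 * (L / INR (N n)) ^ 2)).
    * specialize (HNpos n). apply Rmult_le_compat_l; [lra|]. apply Rmult_le_compat_l.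
      -- apply Rmult_le_pos; [lra|apply pow2_ge_0].
      -- apply pow_incr, Hh.
    * specialize (HNpos n). right. field. lra.
  + apply is_lim_seq_const.
  + replace (Finite 0) with (Rbar_mult (K * (K / m) ^ 2 * L ^ 2) 0) by (simpl; f_equal; ring).
    apply is_lim_seq_scal_l. replace (Finite 0) with (Rbar_inv p_infty) by reflexivity.
    apply is_lim_seq_inv; [|discriminate].
    apply (is_lim_seq_incr_n INR (Datatypes.S N0)), is_lim_seq_INR.
Qed.

Lemma is_derive_of_quadratic (f : C -> C) (z d : C) (K r : R) : 0 < r ->
  (forall w, Cmod (w - z) < r -> Cmod (f w - f z - (w - z) * d) <= K * Cmod (w - z) ^ 2) ->
  @is_derive C_AbsRing C_NormedModule f z d.
Proof.
intros Hr H. split; [apply (is_linear_scal_l (K := C_AbsRing))|].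
intros x Hx. apply (is_filter_lim_locally_unique (K := C_AbsRing) (V := AbsRing_NormedModule C_AbsRing)) in Hx.
subst x. intros eps.
assert (HK : 0 < 1 + Rabs K) by (assert (Q := Rabs_pos K); lra).
assert (He := cond_pos eps).
assert (Hd : 0 < Rmin r (eps / (1 + Rabs K))).
{ apply Rmin_glb_lt; [exact Hr|]. now apply Rdiv_lt_0_compat. }
exists (mkposreal _ Hd). intros w Hw.
change (Cmod (w - z) < Rmin r (eps / (1 + Rabs K))) in Hw.
change (Cmod (f w - f z - (w - z) * d) <= eps * Cmod (w - z)).
assert (H1 : Cmod (w - z) < r) by (eapply Rlt_le_trans; [exact Hw|apply Rmin_l]).
assert (H2 : Cmod (w - z) < eps / (1 + Rabs K)) by (eapply Rlt_le_trans; [exact Hw|apply Rmin_r]).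
eapply Rle_trans; [now apply H|].
apply Rlt_div_r in H2; [|exact HK].
assert (Q := Cmod_ge_0 (w - z)). assert (Q2 := Rle_abs K).
simpl. rewrite Rmult_1_r, <- Rmult_assoc. apply Rmult_le_compat_r; [exact Q|]. nra.
Qed.

(** * The Bessel-Struve kernel *)

(** Summed by components, to match the way [Bnu] takes its limits. *)
Definition Cseries (u : nat -> C) : C :=
  (Series (fun n => Re (u n)), Series (fun n => Im (u n))).

Definition Csummable (u : nat -> C) : Prop := ex_series (fun n => Cmod (u n)).

Lemma Csummable_le (u : nat -> C) (b : nat -> R) :
  (forall n, Cmod (u n) <= b n) -> ex_series b -> Csummable u.
Proof.
intros H Hb. apply (ex_series_le (V := R_CompleteNormedModule) _ b); [|exact Hb].
intros n. unfold norm; simpl; unfold abs; simpl. rewrite Rabs_right; [apply H|].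
apply Rle_ge, Cmod_ge_0.
Qed.

Lemma Csummable_re (u : nat -> C) : Csummable u -> ex_series (fun n => Re (u n)).
Proof.
intros H. apply (ex_series_le (V := R_CompleteNormedModule) _ (fun n => Cmod (u n))); [|exact H].
intros n. apply re_le_Cmod.
Qed.

Lemma Csummable_im (u : nat -> C) : Csummable u -> ex_series (fun n => Im (u n)).
Proof.
intros H. apply (ex_series_le (V := R_CompleteNormedModule) _ (fun n => Cmod (u n))); [|exact H].
intros n. apply im_le_Cmod.
Qed.

Lemma Cseries_minus (u v : nat -> C) : Csummable u -> Csummable v ->
  Cseries (fun n => u n - v n)%C = (Cseries u - Cseries v)%C.
Proof.
intros Hu Hv. unfold Cseries, Cminus, Cplus, Copp; simpl. f_equal.
- change (Series (fun n => Re (u n) - Re (v n)) =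
    Series (fun n => Re (u n)) - Series (fun n => Re (v n))).
  apply Series_minus; now apply Csummable_re.
- change (Series (fun n => Im (u n) - Im (v n)) =
    Series (fun n => Im (u n)) - Series (fun n => Im (v n))).
  apply Series_minus; now apply Csummable_im.
Qed.

Lemma Cseries_scal (c : C) (u : nat -> C) : Csummable u ->
  Cseries (fun n => c * u n)%C = (c * Cseries u)%C.
Proof.
intros Hu. assert (Hr := Csummable_re u Hu). assert (Hi := Csummable_im u Hu).
assert (Ex : forall (k : R) g, ex_series g -> ex_series (fun n => k * g n)).
{ intros k g Hg. apply (ex_series_scal_l (V := R_NormedModule) k g Hg). }
unfold Cseries. rewrite (surjective_pairing (c * _)%C). f_equal; simpl.
- rewrite (Series_ext _ (fun n => Re c * Re (u n) - Im c * Im (u n))) by (intros; apply re_mult).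
  rewrite Series_minus, !Series_scal_l by auto. reflexivity.
- rewrite (Series_ext _ (fun n => Re c * Im (u n) + Im c * Re (u n))) by (intros; apply im_mult).
  rewrite Series_plus, !Series_scal_l by auto. reflexivity.
Qed.

(** Each component contributes one [Series b], whence the 2. *)
Lemma Cmod_Cseries_le (u : nat -> C) (b : nat -> R) :
  (forall n, Cmod (u n) <= b n) -> ex_series b -> Cmod (Cseries u) <= 2 * Series b.
Proof.
intros Hu Hb.
assert (H : forall g : C -> R, (forall c, Rabs (g c) <= Cmod c) ->
  Rabs (Series (fun n => g (u n))) <= Series b).
{ intros g Hg.
  assert (Hgb : forall n, 0 <= Rabs (g (u n)) <= b n).
  { intros n. split; [apply Rabs_pos|]. eapply Rle_trans; [apply Hg|apply Hu]. }
  eapply Rle_trans; [apply Series_Rabs|now apply Series_le].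
  apply (ex_series_le (V := R_CompleteNormedModule) _ b); [|exact Hb].
  intros n. unfold norm; simpl; unfold abs; simpl. rewrite Rabs_Rabsolu. apply Hgb. }
eapply Rle_trans; [apply Cmod_le_Rabs|].
assert (H1 := H Re re_le_Cmod). assert (H2 := H Im im_le_Cmod). simpl in *. lra.
Qed.

Lemma Cseries_first (u : nat -> C) : (forall n, u (S n) = RtoC 0) -> Cseries u = u O.
Proof.
intros H.
assert (Hs : forall g : nat -> R, (forall n, g (S n) = 0) -> Series g = g O).
{ intros g Hg. apply is_series_unique.
  apply (is_lim_seq_ext (fun _ => g O) _ (g O)); [|apply is_lim_seq_const].
  induction n as [|n IH]; [now rewrite sum_O|].
  rewrite sum_Sn, <- IH, Hg. symmetry. apply Rplus_0_r. }
unfold Cseries. rewrite !Hs by (intros n; now rewrite H). now destruct (u O).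
Qed.

(** Passing from [n] to [n + 1] multiplies the remainder by [w] and adds [(n + 1) z^n (w - z)^2];
    and [(n + 1)^2 + (n + 1) <= (n + 2)^2]. *)
Lemma Cpow_taylor_bound (z w : C) (n : nat) : Cmod z <= 1 -> Cmod w <= 1 ->
  Cmod (w ^ S n - z ^ S n - (w - z) * (RtoC (INR n + 1) * z ^ n))
    <= (INR n + 1) ^ 2 * Cmod (w - z) ^ 2.
Proof.
intros Hz Hw. set (D := Cmod (w - z) ^ 2).
assert (HD : 0 <= D) by apply pow2_ge_0.
induction n as [|n IH].
- simpl INR. replace (w ^ 1 - z ^ 1 - (w - z) * (RtoC (0 + 1) * z ^ 0))%C with (RtoC 0).
  + rewrite Cmod_0. simpl; lra.
  + simpl. rewrite RtoC_plus. ring.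
- rewrite S_INR. assert (Hn := pos_INR n).
  replace (w ^ S (S n) - z ^ S (S n) - (w - z) * (RtoC (INR n + 1 + 1) * z ^ S n))%C with
    (w * (w ^ S n - z ^ S n - (w - z) * (RtoC (INR n + 1) * z ^ n))
     + RtoC (INR n + 1) * z ^ n * ((w - z) * (w - z)))%C.
  + eapply Rle_trans; [apply Cmod_triangle|]. rewrite !Cmod_mult, Cmod_R, Rabs_right by lra.
    assert (Hp := Cmod_pow_le_1 z n Hz). assert (Hp0 := Cmod_ge_0 (z ^ n)).
    assert (H0 := Cmod_ge_0 w).
    replace (Cmod (w - z) * Cmod (w - z)) with D by (unfold D; ring).
    set (E := Cmod (w ^ S n - z ^ S n - (w - z) * (RtoC (INR n + 1) * z ^ n))) in *.
    assert (HE : 0 <= E) by apply Cmod_ge_0.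
    assert (Cmod w * E <= E) by nra.
    assert ((INR n + 1) * Cmod (z ^ n) * D <= (INR n + 1) * D).
    { apply Rmult_le_compat_r; [exact HD|]. nra. }
    nra.
  + simpl Cpow. rewrite !RtoC_plus. ring.
Qed.

Lemma pow_n_Cpow (z : C) (n : nat) : pow_n (K := C_Ring) z n = (z ^ n)%C.
Proof. induction n as [|n IH]; [reflexivity|]. simpl. now rewrite IH. Qed.

Lemma Bnu_Cseries (nu : R) (z : C) :
  Bnu nu z = Cseries (fun n => RtoC (BS_coef nu n) * z ^ n)%C.
Proof.
assert (H : forall N, Re (BS_partial nu z N) = sum_n (fun n => Re (RtoC (BS_coef nu n) * z ^ n)%C) N
  /\ Im (BS_partial nu z N) = sum_n (fun n => Im (RtoC (BS_coef nu n) * z ^ n)%C) N).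
{ unfold BS_partial. induction N as [|N [IH1 IH2]].
  - rewrite !sum_O, pow_n_Cpow. split; reflexivity.
  - rewrite !sum_Sn, pow_n_Cpow, <- IH1, <- IH2. split; reflexivity. }
unfold Bnu, Cseries, Series. f_equal; f_equal; apply Lim_seq_ext; intros N; apply H.
Qed.

Lemma BS_coef_bounds (nu : R) (n : nat) : 1 / 2 <= nu ->
  0 < BS_coef nu n <= / INR (fact (S n)).
Proof.
intros Hnu. assert (Hf := INR_fact_lt_0 (S n)).
assert (H1 := bs_moment_pos nu n ltac:(lra)). assert (H2 := bs_moment_le_1 nu n Hnu).
replace (BS_coef nu n) with (bs_moment nu n * / INR (fact (S n)))
  by (unfold bs_moment; field; lra).
assert (H3 := Rinv_0_lt_compat _ Hf). split; [now apply Rmult_lt_0_compat|nra].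
Qed.

(** The weight is that of [Cpow_taylor_bound]. The terms are at most [(n + 1) / n!], the
    coefficients of the derivative of [t exp t]. *)
Lemma ex_series_BS_coef_sqr (nu : R) : 1 / 2 <= nu ->
  ex_series (fun n => (INR n + 1) ^ 2 * BS_coef nu n).
Proof.
intros Hnu.
apply (ex_series_le (V := R_CompleteNormedModule) _
  (PS_derive (PS_incr_1 (fun n => / INR (fact n))))).
- intros n. unfold PS_derive, PS_incr_1.
  destruct (BS_coef_bounds nu n Hnu) as [H1 H2]. assert (Hn := pos_INR n).
  unfold norm; simpl norm; unfold abs; simpl.
  rewrite Rabs_right by (apply Rle_ge, Rmult_le_pos; nra).
  change (match n with 0%nat => 1 | S _ => INR n + 1 end) with (INR (S n)). rewrite S_INR.
  change (fact (S n)) with (S n * fact n)%nat in H2. rewrite mult_INR, S_INR in H2.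
  assert (Hf := INR_fact_lt_0 n).
  apply Rle_trans with ((INR n + 1) ^ 2 * / ((INR n + 1) * INR (fact n))).
  + rewrite Rmult_1_r. simpl. rewrite Rmult_1_r. apply Rmult_le_compat_l; [nra|exact H2].
  + right. field. lra.
- apply ex_pseries_1, CV_radius_inside. rewrite CV_radius_derive, CV_radius_incr_1.
  rewrite exp_dominated_CV_radius; [exact I|].
  exists 1. intros n. rewrite Rabs_right; [right; unfold Rdiv; ring|].
  apply Rle_ge, Rlt_le, Rinv_0_lt_compat, INR_fact_lt_0.
Qed.

Definition bs_deriv (nu : R) (z : C) : C :=
  Cseries (fun n => RtoC ((INR n + 1) * BS_coef nu n) * z ^ n)%C.

Lemma exp_im_real (z : C) (n : nat) : Im z = 0 -> exp_im z n = 0.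
Proof.
intros H. unfold exp_im. replace z with (RtoC (Re z)) by (destruct z; simpl in *; now subst).
rewrite <- RtoC_pow. simpl. unfold Rdiv; ring.
Qed.

Lemma bs_bounds (nu : R) (z : C) : 1 / 2 <= nu -> Cmod z <= 1 ->
  exp (-1) * cos 1 <= Re (bs_deriv nu z) /\ exp (-1) * cos 1 <= Re (Bnu nu z) /\
  0 <= Im z * Im (bs_deriv nu z) /\ 0 <= Im (Bnu nu z) * Im (bs_deriv nu z).
Proof.
intros Hnu Hz. destruct (bs_moment_exp_series nu z Hnu Hz) as (H1 & H2 & H3 & H4).
assert (Hf := INR_fact_neq_0).
assert (Hn1 : forall n, INR n + 1 <> 0) by (intros n; assert (Q := pos_INR n); lra).
assert (E1 : Re (bs_deriv nu z) = Series (fun n => bs_moment nu n * exp_re z n)).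
{ apply Series_ext. intros n. rewrite re_scal_l. unfold bs_moment, exp_re.
  change (fact (S n)) with (S n * fact n)%nat. rewrite mult_INR, S_INR. field. apply Hf. }
assert (E2 : Im (bs_deriv nu z) = Series (fun n => bs_moment nu n * exp_im z n)).
{ apply Series_ext. intros n. rewrite im_scal_l. unfold bs_moment, exp_im.
  change (fact (S n)) with (S n * fact n)%nat. rewrite mult_INR, S_INR. field. apply Hf. }
rewrite Bnu_Cseries.
assert (E3 : Re (Cseries (fun n => RtoC (BS_coef nu n) * z ^ n)%C)
  = Series (fun n => bs_moment nu n * (exp_re z n / (INR n + 1)))).
{ apply Series_ext. intros n. rewrite re_scal_l. unfold bs_moment, exp_re.
  change (fact (S n)) with (S n * fact n)%nat. rewrite mult_INR, S_INR. field. auto. }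
assert (E4 : Im (Cseries (fun n => RtoC (BS_coef nu n) * z ^ n)%C)
  = Series (fun n => bs_moment nu n * (exp_im z n / (INR n + 1)))).
{ apply Series_ext. intros n. rewrite im_scal_l. unfold bs_moment, exp_im.
  change (fact (S n)) with (S n * fact n)%nat. rewrite mult_INR, S_INR. field. auto. }
rewrite E1, E2, E3, E4. repeat split; try assumption.
set (s := Series (fun n => bs_moment nu n * exp_im z n)) in *.
set (s' := Series (fun n => bs_moment nu n * (exp_im z n / (INR n + 1)))) in *.
(* Off the real axis both factors have the sign of [Im z]; on it the imaginary part of the
   derivative vanishes. *)
destruct (Req_dec (Im z) 0) as [H|H].
2:{ assert (0 < Im z * Im z) by now apply Rsqr_pos_lt.
    assert (Q := Rmult_le_pos _ _ H3 H4). apply Rmult_le_reg_l with (Im z * Im z); [assumption|].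
    rewrite Rmult_0_r. lra. }
assert (Z : s = 0).
{ unfold s. rewrite (Series_ext _ (fun _ => 0 * 0)).
  - rewrite Series_scal_l. ring.
  - intros n. rewrite exp_im_real by exact H. ring. }
rewrite Z. lra.
Qed.

(** The lower constant is squared because the radial bound multiplies two lower bounds; being at
    most 1 before squaring, it still bounds [Re f'] from below. The 2 comes from
    [Cmod_Cseries_le]. *)
Lemma bs_starlike_data (nu : R) : 1 / 2 <= nu ->
  starlike_data (fun z => z * Bnu nu z)%C (bs_deriv nu) (Bnu nu)
    ((exp (-1) * cos 1) ^ 2) (2 * Series (fun n => (INR n + 1) ^ 2 * BS_coef nu n)).
Proof.
intros Hnu.
set (b := fun n => (INR n + 1) ^ 2 * BS_coef nu n).
assert (Hb : ex_series b) by now apply ex_series_BS_coef_sqr.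
assert (Hc : forall n, 0 < BS_coef nu n) by (intros n; apply (BS_coef_bounds nu n Hnu)).
assert (Hn : forall n, 0 <= INR n) by apply pos_INR.
assert (Hc0 : 0 < exp (-1) * cos 1).
{ apply Rmult_lt_0_compat; [apply exp_pos|]. apply cos_gt_0; assert (Q := PI2_1); lra. }
assert (Hc1 : exp (-1) * cos 1 <= 1).
{ assert (exp (-1) < exp 0) by (apply exp_increasing; lra). rewrite exp_0 in *.
  assert (Q := COS_bound 1). assert (Q2 := exp_pos (-1)). nra. }
assert (Hterm : forall (g : nat -> R) z n, 0 <= g n <= (INR n + 1) ^ 2 -> Cmod z < 1 ->
  Cmod (RtoC (g n * BS_coef nu n) * z ^ n) <= b n).
{ intros g z n Hg Hz. specialize (Hc n).
  rewrite Cmod_mult, Cmod_R, Rabs_right by (apply Rle_ge, Rmult_le_pos; lra).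
  assert (Q := Cmod_pow_le_1 z n ltac:(lra)). assert (Q0 := Cmod_ge_0 (z ^ n)).
  unfold b. assert (0 <= g n * BS_coef nu n) by (apply Rmult_le_pos; lra).
  apply Rle_trans with (g n * BS_coef nu n); [nra|]. apply Rmult_le_compat_r; lra. }
assert (TB : forall z, Cmod z < 1 -> forall n, Cmod (RtoC (BS_coef nu n) * z ^ n) <= b n).
{ intros z Hz n. specialize (Hterm (fun _ => 1) z n). rewrite Rmult_1_l in Hterm.
  apply Hterm; [|exact Hz]. specialize (Hn n). nra. }
assert (TD : forall z, Cmod z < 1 -> forall n,
  Cmod (RtoC ((INR n + 1) * BS_coef nu n) * z ^ n) <= b n).
{ intros z Hz n. apply (Hterm (fun n => INR n + 1)); [|exact Hz]. specialize (Hn n). nra. }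
split.
- now apply pow_lt.
- reflexivity.
- intros z w Hz Hw. rewrite !Bnu_Cseries. unfold bs_deriv.
  assert (SB : forall z, Cmod z < 1 -> Csummable (fun n => RtoC (BS_coef nu n) * z ^ n)%C).
  { intros u Hu. apply Csummable_le with b; auto. }
  assert (SD : Csummable (fun n => RtoC ((INR n + 1) * BS_coef nu n) * z ^ n)%C).
  { apply Csummable_le with b; auto. }
  assert (SS : forall c u, Csummable u -> Csummable (fun n => c * u n)%C).
  { intros c u Hu. apply Csummable_le with (fun n => Cmod c * Cmod (u n)).
    - intros n. rewrite Cmod_mult. lra.
    - apply (ex_series_scal_l (V := R_NormedModule) (Cmod c)), Hu. }
  assert (SM : forall u v, Csummable u -> Csummable v -> Csummable (fun n => u n - v n)%C).
  { intros u v Hu Hv. apply Csummable_le with (fun n => Cmod (u n) + Cmod (v n)).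
    - intros n. eapply Rle_trans; [apply Cmod_triangle|]. rewrite Cmod_opp. lra.
    - apply (ex_series_plus (V := R_NormedModule)); assumption. }
  rewrite <- !Cseries_scal, <- !Cseries_minus by auto.
  replace (2 * Series b * Cmod (w - z) ^ 2) with (2 * Series (fun n => b n * Cmod (w - z) ^ 2))
    by (rewrite Series_scal_r; ring).
  apply Cmod_Cseries_le.
  + intros n. replace (_ - _ - _)%C with (RtoC (BS_coef nu n) *
      (w ^ S n - z ^ S n - (w - z) * (RtoC (INR n + 1) * z ^ n)))%C.
    * rewrite Cmod_mult, Cmod_R, Rabs_right by (apply Rle_ge, Rlt_le, Hc).
      unfold b. rewrite (Rmult_comm _ (BS_coef nu n)), Rmult_assoc.
      apply Rmult_le_compat_l; [apply Rlt_le, Hc|]. apply Cpow_taylor_bound; lra.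
    * rewrite RtoC_mult. simpl Cpow. ring.
  + now apply ex_series_scal_r.
- intros z Hz. destruct (bs_bounds nu z Hnu ltac:(lra)) as (H & _). nra.
- intros z Hz. now apply Cmod_Cseries_le; [apply TD|].
- intros z Hz. rewrite Bnu_Cseries. now apply Cmod_Cseries_le; [apply TB|].
- intros z Hz. destruct (bs_bounds nu z Hnu ltac:(lra)) as (H1 & H2 & _ & H4).
  rewrite re_mult. unfold Cconj; simpl.
  unfold Re, Im in *. simpl in *. nra.
Qed.

(** * Starlikeness of [f] and of the two comparison functions *)

Lemma starlike_of_data f df B m K :
  starlike_data f df B m K -> df (RtoC 0) = RtoC 1 ->
  starlike f /\ forall z, in_disk z -> @is_derive C_AbsRing C_NormedModule f z (df z).
Proof.
intros S H0.
assert (HD : forall z, in_disk z -> @is_derive C_AbsRing C_NormedModule f z (df z)).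
{ intros z Hz. unfold in_disk in Hz.
  apply is_derive_of_quadratic with K (1 - Cmod z); [lra|]. intros w Hw.
  apply (sd_quad _ _ _ _ _ S); [exact Hz|].
  replace w with (z + (w - z))%C by ring. eapply Rle_lt_trans; [apply Cmod_triangle|]. lra. }
split; [|exact HD]. split; [split; [|split]|split].
- intros z Hz. exists (df z). auto.
- rewrite (sd_fun _ _ _ _ _ S). ring.
- rewrite <- H0. apply HD. unfold in_disk. rewrite Cmod_0. lra.
- intros z w. apply (univalent _ _ _ _ _ S).
- intros z t. apply (starlike_image _ _ _ _ _ S).
Qed.

(* [is_derive_id] concerns the module structure [AbsRing_NormedModule C_AbsRing]
   on the codomain, which differs from [C_NormedModule]. *)
Lemma is_derive_C_id (z : C) :
  @is_derive C_AbsRing C_NormedModule (fun z => z) z (RtoC 1).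
Proof.
apply is_derive_of_quadratic with 0 1; [lra|]. intros w _.
replace (w - z - (w - z) * RtoC 1)%C with (RtoC 0) by ring. rewrite Cmod_0. lra.
Qed.

Lemma starlike_id : starlike (fun z => z).
Proof.
split; [split; [|split]|split].
- intros z _. exists (RtoC 1). apply is_derive_C_id.
- reflexivity.
- apply is_derive_C_id.
- auto.
- intros z t Hz Ht. exists (RtoC t * z)%C. split; [|reflexivity]. unfold in_disk in *.
  rewrite Cmod_mult, Cmod_R, Rabs_right by lra. assert (Q := Cmod_ge_0 z). nra.
Qed.

Lemma one_minus_neq_0 (z : C) : Cmod z < 1 -> (RtoC 1 - z)%C <> RtoC 0.
Proof.
intros Hz E. assert (E1 : z = RtoC 1).
{ transitivity (RtoC 1 - (RtoC 1 - z))%C; [ring|]. rewrite E. ring. }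
rewrite E1, Cmod_1 in Hz. lra.
Qed.

(** The remainder is exactly [(w - z)^2 / ((1 - w) (1 - z)^2)], and [|1 - w| >= c / 2] on the chosen
    ball. *)
Lemma is_derive_half_plane_map (z : C) : Cmod z < 1 ->
  @is_derive C_AbsRing C_NormedModule (fun z => (z / (RtoC 1 - z))%C) z
    (/ ((RtoC 1 - z) * (RtoC 1 - z)))%C.
Proof.
intros Hz. set (c := Cmod (RtoC 1 - z)).
assert (Hz1 := one_minus_neq_0 z Hz).
assert (Hc : 0 < c) by now apply Cmod_gt_0.
apply is_derive_of_quadratic with (2 / c ^ 3) (Rmin (c / 2) (1 - Cmod z)).
{ apply Rmin_glb_lt; lra. }
intros w Hw.
assert (Hw1 : Cmod (w - z) < c / 2) by (eapply Rlt_le_trans; [exact Hw|apply Rmin_l]).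
assert (Hwd : c / 2 <= Cmod (RtoC 1 - w)).
{ assert (Q := Cmod_triangle (RtoC 1 - w) (w - z)).
  replace (RtoC 1 - w + (w - z))%C with (RtoC 1 - z)%C in Q by ring. fold c in Q. lra. }
assert (Hwn : (RtoC 1 - w)%C <> RtoC 0) by (apply Cmod_gt_0; lra).
replace (w / (RtoC 1 - w) - z / (RtoC 1 - z) - (w - z) * / ((RtoC 1 - z) * (RtoC 1 - z)))%C
  with ((w - z) * (w - z) / ((RtoC 1 - w) * ((RtoC 1 - z) * (RtoC 1 - z))))%C
  by (field; auto).
rewrite Cmod_div by (repeat apply Cmult_neq_0; auto). rewrite !Cmod_mult. fold c.
replace (2 / c ^ 3 * Cmod (w - z) ^ 2) with (Cmod (w - z) * Cmod (w - z) * / (c / 2 * (c * c)))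
  by (field; lra).
apply Rmult_le_compat_l; [apply Rmult_le_pos; apply Cmod_ge_0|].
apply Rinv_le_contravar; [repeat apply Rmult_lt_0_compat; lra|].
apply Rmult_le_compat_r; [nra|exact Hwd].
Qed.

Lemma starlike_half_plane_map : starlike (fun z => (z / (RtoC 1 - z))%C).
Proof.
split; [split; [|split]|split].
- intros z Hz. eexists. now apply is_derive_half_plane_map.
- unfold Cdiv. ring.
- assert (H := is_derive_half_plane_map (RtoC 0) ltac:(rewrite Cmod_0; lra)).
  replace (/ ((RtoC 1 - RtoC 0) * (RtoC 1 - RtoC 0)))%C with (RtoC 1) in H; [exact H|].
  unfold RtoC, Cinv, Cmult, Cminus, Cplus, Copp; simpl. f_equal; field.
- intros z w Hz Hw E. assert (Hz1 := one_minus_neq_0 z Hz). assert (Hw1 := one_minus_neq_0 w Hw).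
  transitivity ((RtoC 1 - z) * (RtoC 1 - w) * (z / (RtoC 1 - z)) + z * w)%C; [field; auto|].
  rewrite E. field. auto.
- intros z t Hz Ht. unfold in_disk in *. assert (Hz1 := one_minus_neq_0 z Hz).
  (* The inverse map [u / (1 + u)] sends [t z / (1 - z)] to [t z / d]. This lies in the disk since
     [|d| >= 1 - (1 - t) |z| > t |z|]. *)
  set (d := (RtoC 1 - z + RtoC t * z)%C).
  assert (Hlt : Cmod (RtoC t * z) < Cmod d).
  { assert (Q := Cmod_triangle d (RtoC (1 - t) * z)).
    replace (d + RtoC (1 - t) * z)%C with (RtoC 1) in Q by (unfold d; rewrite RtoC_minus; ring).
    rewrite Cmod_1, !Cmod_mult, !Cmod_R, !Rabs_right in * by lra. lra. }
  assert (Hd : d <> RtoC 0).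
  { apply Cmod_gt_0. assert (Q := Cmod_ge_0 (RtoC t * z)). lra. }
  exists (RtoC t * z / d)%C. split.
  + rewrite Cmod_div by exact Hd. assert (Q := Cmod_ge_0 (RtoC t * z)).
    apply Rlt_div_l; lra.
  + assert (E : (RtoC 1 - RtoC t * z / d)%C = ((RtoC 1 - z) / d)%C) by (unfold d; field; exact Hd).
    rewrite E. field. auto.
Qed.

Theorem theorem3 (nu : R) (hnu : 1 / 2 <= nu) :
  starlike (fun z => (z * Bnu nu z)%C) /\
  close_to_convex_wrt (fun z => (z * Bnu nu z)%C) (fun z => z) /\
  close_to_convex_wrt (fun z => (z * Bnu nu z)%C) (fun z => (z / (RtoC 1 - z))%C).
Proof.
assert (D0 : bs_deriv nu (RtoC 0) = RtoC 1).
{ unfold bs_deriv. rewrite Cseries_first; [|intros n; simpl; ring].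
  assert (Q := bs_moment_0 nu ltac:(lra)). unfold bs_moment in Q. simpl in Q.
  simpl. replace ((0 + 1) * BS_coef nu 0) with 1 by lra. ring. }
destruct (starlike_of_data _ _ _ _ _ (bs_starlike_data nu hnu) D0) as [HS HD].
assert (Hpos : 0 < exp (-1) * cos 1).
{ apply Rmult_lt_0_compat; [apply exp_pos|]. apply cos_gt_0; assert (Q := PI2_1); lra. }
assert (Hrot : forall c : C, ((cos 0, sin 0) * c)%C = c).
{ intros c. rewrite cos_0, sin_0. apply (Cmult_1_l c). }
assert (H0 : Re (bs_deriv nu (RtoC 0)) = 1) by (rewrite D0; reflexivity).
split; [exact HS|]. split; (split; [apply HS|]).
- split; [apply starlike_id|]. exists 0. intros z Hz.
  exists (bs_deriv nu z), (RtoC 1). destruct (bs_bounds nu z hnu) as (H & _); [now left|].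
  split; [now apply HD|]. split; [apply is_derive_C_id|].
  split; intros Hz0; rewrite Hrot.
  + replace (z * bs_deriv nu z / z)%C with (bs_deriv nu z) by (field; exact Hz0). lra.
  + replace (bs_deriv nu z / RtoC 1)%C with (bs_deriv nu z) by (field; apply C1_nz). lra.
- split; [apply starlike_half_plane_map|]. exists 0. intros z Hz.
  exists (bs_deriv nu z), (/ ((RtoC 1 - z) * (RtoC 1 - z)))%C.
  destruct (bs_bounds nu z hnu) as (H & _ & H' & _); [now left|].
  assert (Hz1 := one_minus_neq_0 z Hz).
  split; [now apply HD|]. split; [now apply is_derive_half_plane_map|].
  split; intros Hz0; rewrite Hrot.
  + replace (z * bs_deriv nu z / (z / (RtoC 1 - z)))%C with ((RtoC 1 - z) * bs_deriv nu z)%C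
      by (field; auto).
    assert (Hx : Re z < 1).
    { eapply Rle_lt_trans; [apply Rle_abs|]. eapply Rle_lt_trans; [apply re_le_Cmod|exact Hz]. }
    rewrite re_mult. replace (Re (RtoC 1 - z)) with (1 - Re z) by (destruct z; reflexivity).
    replace (Im (RtoC 1 - z)) with (- Im z) by (destruct z; simpl; ring). nra.
  + subst z. rewrite D0.
    replace (RtoC 1 / / ((RtoC 1 - RtoC 0) * (RtoC 1 - RtoC 0)))%C with (RtoC 1) by (field; exact Hz1).
    simpl. lra.
Qed.
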